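(* Let $d\ge1$ and let $\nu(\mathbf x)=\prod_{l=1}^dc_\mu(1+x_l^2)^{-(\mu+1)/2}$, $\mu>0$, be the product Student density on $\mathbb R^d$. Let $q\ge0$ and $i\in\{0,\dots,N\}$. Assume that the value function $y_i$ is $r$ times ($r\ge1$) coordinate-wise continuously differentiable on $\mathbb R^d$ and that there is $p\in\mathbb N$ such that $$\limsup_{|\mathbf x|\to+\infty}\frac{|\partial^n_{x_l}y_i(\mathbf x)|}{|\mathbf x|^{p-n}}<+\infty,\qquad n=0,\dots,r,\ l=1,\dots,d .$$ Assume $p+(r-\tfrac12)\mu<q$. Then, for all $K_1,\dots,K_d\in\mathbb N$, the coefficients $(\alpha^{(q)}_{i,\mathbf k})_{\mathbf k\in\mathbb N^d}$ satisfy $$\sum_{\mathbf k\in\mathbb N^d:\ \exists l,\ k_l>K_l}|\alpha^{(q)}_{i,\mathbf k}|^2\le\sum_{l=1}^d\frac{C^{(l,r)}}{(K_l+1)^{2r}},\qquad\text{where}\quad C^{(l,r)}:=\frac1{\pi^{2r}}\int_{[0,1]^d}|\partial^r_{u_l}h^{(q)}_i(\mathbf u)|^2d\mathbf u<+\infty .$$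
   Context: $\mathbb N=\{0,1,\dots\}$; $|\cdot|$ is the Euclidean norm; ''$r$ times coordinate-wise continuously differentiable'' means that the pure partial derivatives $\partial^n_{x_l}y_i$ exist and are continuous for $n\le r$ and all $l$. $c_\mu>0$ normalizes each one-dimensional factor $\nu_l$; $F_{\nu_l}(x)=\int_{-\infty}^x\nu_l$; $F_\nu^{-1}(\mathbf u)=(F_{\nu_1}^{-1}(u_1),\dots,F_{\nu_d}^{-1}(u_d))$ on $(0,1)^d$. $y^{(q)}_i(\mathbf x):=y_i(\mathbf x)/(1+|\mathbf x|^2)^{q/2}$ and $h^{(q)}_i:=y^{(q)}_i\circ F_\nu^{-1}$. $\alpha^{(q)}_{i,\mathbf k}:=\int_{\mathbb R^d}y^{(q)}_i\phi_{\mathbf k}\,\nu\,d\mathbf x$, where $\phi_{\mathbf k}(\mathbf x)=\prod_{l=1}^d\phi^{(l)}_{k_l}(x_l)$, $\phi^{(l)}_0\equiv1$, $\phi^{(l)}_k(x)=\sqrt2\cos(k\pi F_{\nu_l}(x))$ for $k\ge1$. Value functions: $T>0$, $N\ge1$, $\Delta=T/N$, $t_j=j\Delta$; $b:[0,T]\times\mathbb R^d\to\mathbb R^d$ and $\sigma:[0,T]\times\mathbb R^d\to\mathbb R^{d\times d_W}$ are bounded measurable; $W$ is a standard $d_W$-dimensional Brownian motion; $X_{j+1}=X_j+b(t_j,X_j)\Delta+\sigma(t_j,X_j)(W_{t_{j+1}}-W_{t_j})$; $g$ is measurable with $|g(\mathbf x)|\le C_g(1+|\mathbf x|^2)^{\eta_g/2}$;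 $f_j(\mathbf x,y)=f(t_j,\mathbf x,y)$ is measurable, $|f_j(\mathbf x,y)-f_j(\mathbf x,y')|\le L_f|y-y'|$, $|f_j(\mathbf x,0)|\le C_f(1+|\mathbf x|^2)^{\eta_f/2}$ (finite nonnegative constants). Then $y_N=g$ and $y_i(\mathbf x)=\mathbb E[g(X_N)+\sum_{j=i}^{N-1}f_j(X_j,y_{j+1}(X_{j+1}))\Delta\mid X_i=\mathbf x]$ for $i<N$. *)

(* Defs.v *)
From HB Require Import structures.
From mathcomp Require Import all_boot all_order all_algebra.
From mathcomp Require Import all_classical all_reals all_analysis.
Set Implicit Arguments.
Unset Strict Implicit.
Unset Printing Implicit Defensive.
Import Order.TTheory GRing.Theory Num.Theory.
Import numFieldNormedType.Exports.
Local Open Scope classical_set_scope.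
Local Open Scope ring_scope.

Definition measure_matrix_display : measure_display.
Proof. exact: default_measure_display. Qed.

Section measurable_matrix.
Context {R : realType} {m n : nat}.

(* The product sigma-algebra of R^(m x n); it coincides with the Borel one. *)
Definition matrix_measurable : set (set 'M[R]_(m, n)) :=
  <<s \bigcup_(ij in [set: 'I_m * 'I_n])
        preimage_set_system setT (fun A : 'M[R]_(m, n) => A ij.1 ij.2)
          measurable >>.

Let matrix_set0 : matrix_measurable set0.
Proof. exact: sigma_algebra0. Qed.

Let matrix_setC A : matrix_measurable A -> matrix_measurable (~` A).
Proof. exact: sigma_algebraC. Qed.

Let matrix_bigcup (F : (set 'M[R]_(m, n))^nat) :
  (forall i, matrix_measurable (F i)) -> matrix_measurable (\bigcup_i (F i)).
Proof. exact: sigma_algebra_bigcup. Qed.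

HB.instance Definition _ :=
  @isMeasurable.Build measure_matrix_display
    'M[R]_(m, n) matrix_measurable matrix_set0 matrix_setC matrix_bigcup.

Lemma measurable_coord (i : 'I_m) (j : 'I_n) :
  measurable_fun setT (fun A : 'M[R]_(m, n) => A i j).
Proof.
move=> _ B mB; apply: sub_sigma_algebra.
by exists (i, j) => //; exists B.
Qed.

Lemma measurable_fun_matrix d (T : measurableType d) (f : T -> 'M[R]_(m, n)) :
  (forall i j, measurable_fun setT (fun t => f t i j)) -> measurable_fun setT f.
Proof.
move=> mf; apply: (@measurability _ _ _ _ _ _
  (\bigcup_(ij in [set: 'I_m * 'I_n])
     preimage_set_system setT (fun A : 'M[R]_(m, n) => A ij.1 ij.2)
       measurable)) => //.
move=> _ [_ [[i j] _ [B mB <-]] <-]; rewrite !setTI.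
by have := mf i j measurableT B mB; rewrite setTI.
Qed.

End measurable_matrix.

Section lebesgue_measure_rV.
Context {R : realType}.

Definition cons_rV n (z : R * 'rV[R]_n) : 'rV[R]_n.+1 :=
  row_mx (const_mx z.1 : 'M[R]_1) z.2.

Definition uncons_rV n (v : 'rV[R]_n.+1) : R * 'rV[R]_n :=
  (v 0 0, \row_j v 0 (lift ord0 j)).

Lemma cons_rV0 n (z : R * 'rV[R]_n) : cons_rV z 0 0 = z.1.
Proof.
transitivity (row_mx (const_mx z.1 : 'M[R]_1) z.2 0 (lshift n 0)).
  by congr (cons_rV z 0 _); exact: val_inj.
by rewrite row_mxEl mxE.
Qed.

Lemma cons_rVS n (z : R * 'rV[R]_n) j : cons_rV z 0 (lift ord0 j) = z.2 0 j.
Proof.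
transitivity (row_mx (const_mx z.1 : 'M[R]_1) z.2 0 (rshift 1 j)).
  by congr (cons_rV z 0 _); exact: val_inj.
by rewrite row_mxEr.
Qed.

Lemma cons_rVK n : cancel (@cons_rV n) (@uncons_rV n).
Proof.
move=> [x v]; rewrite /uncons_rV cons_rV0/=; congr pair.
by apply/rowP => j; rewrite mxE cons_rVS.
Qed.

Lemma uncons_rVK n : cancel (@uncons_rV n) (@cons_rV n).
Proof.
move=> v; apply/rowP => j; case: (unliftP ord0 j) => [k|] ->.
  by rewrite cons_rVS mxE.
by rewrite cons_rV0.
Qed.

Lemma measurable_cons_rV n : measurable_fun setT (@cons_rV n).
Proof.
apply: measurable_fun_matrix => i j; rewrite ord1.
case: (unliftP ord0 j) => [k|] ->.
  under eq_fun do rewrite cons_rVS.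
  apply: (measurableT_comp (measurable_coord 0 k) measurable_snd).
under eq_fun do rewrite cons_rV0.
exact: measurable_fst.
Qed.

Lemma measurable_uncons_rV n : measurable_fun setT (@uncons_rV n).
Proof.
apply/measurable_fun_pairP; split => /=.
  exact: measurable_coord.
apply: measurable_fun_matrix => i j /=.
by under eq_fun do rewrite mxE; exact: measurable_coord.
Qed.

Section cons_measure.
Variables (n : nat) (mu : {sigma_finite_measure set 'rV[R]_n -> \bar R}).

Definition cons_measure : set 'rV[R]_n.+1 -> \bar R :=
  pushforward (@lebesgue_measure R \x mu)%E (@cons_rV n).

Let mcons := @measurable_cons_rV n.

Let cons_measure0 : cons_measure set0 = 0%E.
Proof. exact: measure0. Qed.

Let cons_measure_ge0 A : (0 <= cons_measure A)%E.
Proof. exact: measure_ge0. Qed.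

Let cons_measure_sigma_additive : semi_sigma_additive cons_measure.
Proof. exact: measure_semi_sigma_additive. Qed.

HB.instance Definition _ := isMeasure.Build _ _ _ cons_measure
  cons_measure0 cons_measure_ge0 cons_measure_sigma_additive.

Let cons_measure_sigma_finite : sigma_finite setT cons_measure.
Proof.
have /sigma_finiteP[F [TF ndF Foo]] := sigma_finiteT (@lebesgue_measure R).
have /sigma_finiteP[G [TG ndG Goo]] := sigma_finiteT mu.
exists (fun k => @uncons_rV n @^-1` (F k `*` G k)).
  apply/seteqP; split => // v _ /=.
  have [k _ Fk] : (\bigcup_i F i) (v 0 0) by rewrite -TF.
  have [l _ Gl] : (\bigcup_i G i) (uncons_rV v).2 by rewrite -TG.
  exists (maxn k l) => //; split => /=.
    by have /subsetPset := ndF _ _ (leq_maxl k l); exact.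
  by have /subsetPset := ndG _ _ (leq_maxr k l); exact.
move=> k; have [mF Fk] := Foo k; have [mG Gk] := Goo k; split.
  rewrite -[X in measurable X]setTI; apply: measurable_uncons_rV => //.
  exact: measurableX.
rewrite /cons_measure /pushforward -comp_preimage.
rewrite (_ : _ \o _ = id); last by apply/funext => z /=; rewrite cons_rVK.
by rewrite preimage_id product_measure1E// lte_mul_pinfty// ge0_fin_numE.
Qed.

HB.instance Definition _ := Measure_isSigmaFinite.Build _ _ _ cons_measure
  cons_measure_sigma_finite.

End cons_measure.

Fixpoint lebesgue_rV n : {sigma_finite_measure set 'rV[R]_n -> \bar R} :=
  match n with
  | 0 => \d_ (0 : 'rV[R]_0)
  | n'.+1 => cons_measure (lebesgue_rV n')
  end.

Lemma lebesgue_rV_box n (A : 'I_n -> set R) : (forall l, measurable (A l)) ->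
  lebesgue_rV n [set x | forall l, A l (x 0 l)]
  = (\prod_(l < n) @lebesgue_measure R (A l))%E.
Proof.
elim: n A => [|n IHn] A mA.
  by rewrite big_ord0 /= diracE mem_set//= => -[].
have mS : measurable [set x : 'rV[R]_n | forall l, A (lift ord0 l) (x 0 l)].
  rewrite (_ : [set _ | _] = \bigcap_(l in [set: 'I_n])
      (fun x : 'rV[R]_n => x 0 l) @^-1` A (lift ord0 l)); last first.
    by apply/seteqP; split => [x h l _|x h l]; exact: h.
  apply: fin_bigcap_measurable => // l _.
  by rewrite -[X in measurable X]setTI; exact: measurable_coord.
rewrite big_ord_recl -IHn//= -product_measure1E//.
rewrite /cons_measure /pushforward; congr (_ _).
apply/seteqP; split => [[x v] /= h|[x v] [/= h0 hS] l].
  split => /= [|l]; first by have := h ord0; rewrite cons_rV0.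
  by have := h (lift ord0 l); rewrite cons_rVS.
by case: (unliftP ord0 l) => [k|] ->; rewrite ?cons_rV0// cons_rVS.
exact: mA.
Qed.

End lebesgue_measure_rV.

Section pure_partial_derivatives.
Context {R : realType} {d : nat}.
Implicit Types (f : 'rV[R]_d -> R) (A : set 'rV[R]_d).

Definition enorm (x : 'rV[R]_d) : R := Num.sqrt (\sum_(l < d) x 0 l ^+ 2).

Definition enorm_pinfty : set_system 'rV[R]_d :=
  filter_from setT (fun M : R => [set x | M < enorm x]).

Definition partialn (l : 'I_d) (n : nat) f : 'rV[R]_d -> R :=
  iter n (fun g => 'D_(delta_mx 0 l) g) f.

(* As 'D_v is total, the existence of the n-th pure partial derivative is
   stated through the derivability of the lower ones; continuity is joint. *)
Definition coordinatewise_C (r : nat) A f : Prop := forall l : 'I_d,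
  (forall n, (n < r)%N -> forall x, A x ->
     derivable (partialn l n f) x (delta_mx 0 l)) /\
  (forall n, (n <= r)%N -> forall x, A x -> {for x, continuous (partialn l n f)}).

End pure_partial_derivatives.

Section student.
Context {R : realType}.
Variable mu : R.

Definition student_cst : R :=
  (\int[lebesgue_measure]_t (1 + t ^+ 2) `^ (- (mu + 1) / 2))^-1.

Definition student1 (t : R) : R :=
  student_cst * (1 + t ^+ 2) `^ (- (mu + 1) / 2).

Definition student d (x : 'rV[R]_d) : R := \prod_(l < d) student1 (x 0 l).

Definition student_cdf (x : R) : R :=
  \int[lebesgue_measure]_(t in `]-oo, x]) student1 t.

(* The inverse on (0, 1); 0 at points outside the range of the cdf. *)
Definition student_quantile : R -> R := 'pinv_(fun=> 0) setT student_cdf.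

Definition student_quantiles d (u : 'rV[R]_d) : 'rV[R]_d :=
  \row_l student_quantile (u 0 l).

Definition phi1 (k : nat) (x : R) : R :=
  if k is 0 then 1 else Num.sqrt 2 * cos (k%:R * pi * student_cdf x).

Definition phi d (k : {ffun 'I_d -> nat}) (x : 'rV[R]_d) : R :=
  \prod_(l < d) phi1 (k l) (x 0 l).

End student.

Section damped_coefficients.
Context {R : realType} {d : nat}.
Variables (mu q : R) (y : 'rV[R]_d -> R).

Definition damped (x : 'rV[R]_d) : R := y x / (1 + enorm x ^+ 2) `^ (q / 2).

Definition damped_cube (u : 'rV[R]_d) : R := damped (student_quantiles mu u).

Definition coef_integrand (k : {ffun 'I_d -> nat}) (x : 'rV[R]_d) : R :=
  damped x * phi mu k x * student mu x.

Definition coef (k : {ffun 'I_d -> nat}) : R :=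
  \int[lebesgue_rV d]_x coef_integrand k x.

Definition open_cube : set 'rV[R]_d := [set u | forall l, 0 < u 0 l < 1].

(* The faces of [0, 1]^d, where the quantiles are undefined, are null sets. *)
Definition smoothness_cst (l : 'I_d) (r : nat) : \bar R :=
  ((pi ^- (2 * r))%:E *
   \int[lebesgue_rV d]_(u in open_cube)
     (`|partialn l r damped_cube u| ^+ 2)%:E)%E.

End damped_coefficients.

Section value_functions.
Context {R : realType} {dOmega : measure_display} {Omega : measurableType dOmega}.
Variable P : probability Omega R.

(* The law of the increments says that all the coordinates of all the
   increments over disjoint intervals are mutually independent, with respective
   laws N(0, s_(k+1) - s_k); normal_prob takes the standard deviation. *)
Definition brownian_motion (dW : nat) (W : R -> Omega -> 'rV[R]_dW) : Prop :=
  [/\ forall t, 0 <= t -> measurable_fun setT (W t),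
      {ae P, forall w, W 0 w = 0},
      {ae P, forall w, {within `[0, +oo[, continuous (W ^~ w)}} &
      forall (n : nat) (s : nat -> R) (B : 'I_n -> 'I_dW -> set R),
        0 <= s 0%N -> (forall k, (k < n)%N -> s k < s k.+1) ->
        (forall k m, measurable (B k m)) ->
        P [set w | forall k m, B k m ((W (s k.+1) w - W (s k) w) 0 m)] =
        (\prod_(k < n) \prod_(m < dW)
           normal_prob 0 (Num.sqrt (s k.+1 - s k)) (B k m))%E].

Variables (d dW : nat) (W : R -> Omega -> 'rV[R]_dW).
Variables (T : R) (N : nat).

Definition time_step : R := T / N%:R.

Definition grid (j : nat) : R := j%:R * time_step.

Variables (b : R -> 'rV[R]_d -> 'rV[R]_d) (sigma : R -> 'rV[R]_d -> 'M[R]_(d, dW)).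

(* X_(i+m) for the scheme started at X_i = x; vectors are rows, whence the
   transposition of sigma. *)
Fixpoint euler_steps (i : nat) (x : 'rV[R]_d) (m : nat) (w : Omega) : 'rV[R]_d :=
  if m is m'.+1 then
    let X := euler_steps i x m' w in
    let j := (i + m')%N in
    X + time_step *: b (grid j) X +
      (W (grid j.+1) w - W (grid j) w) *m (sigma (grid j) X)^T
  else x.

Definition euler (i : nat) (x : 'rV[R]_d) (j : nat) : Omega -> 'rV[R]_d :=
  euler_steps i x (j - i).

Variables (g : 'rV[R]_d -> R) (f : R -> 'rV[R]_d -> R -> R).

(* Conditioning on X_i = x means that the scheme starts from x at time t_i. *)
Definition value_functions (y : nat -> 'rV[R]_d -> R) : Prop :=
  (forall x, y N x = g x) /\
  (forall i x, (i < N)%N ->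
     ((y i x)%:E = 'E_P[fun w => (g (euler i x N w) +
       \sum_(i <= j < N)
          f (grid j) (euler i x j w) (y j.+1 (euler i x j.+1 w)) * time_step)%R])%E).

End value_functions.

(* Main.v *)
Require Import Defs.
From mathcomp Require Import all_boot all_order all_algebra.
From mathcomp Require Import all_classical all_reals all_analysis.
From mathcomp Require Import measurable_realfun ring lra.
Set Implicit Arguments.
Unset Strict Implicit.
Unset Printing Implicit Defensive.
Import Order.TTheory GRing.Theory Num.Theory.
Import numFieldNormedType.Exports.
Local Open Scope classical_set_scope.
Local Open Scope ring_scope.

(** The pure partial derivatives of order [n] of the damped function [h] on the
    cube are those of the damped function on the whole space, transported by
    the quantiles: [d/du_l] becomes the weighted derivative
    [D f x = 'D_l f x / student1 mu (x l)]. Starting from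
    [y (1 + |x|^2)^(-q/2)], the iterates [D^n] are finite sums of terms
    [c x_l^a (1 + x_l^2)^s (1 + |x|^2)^t ('D_l)^k y], and the growth assumption
    on [y] together with two linear inequalities on the exponents, preserved by
    [D], gives the bound ([wderiv_bound])
      [|D^n| <= C (1 + x_l^2)^(n mu / 2) (1 + |x|^2)^((p - q) / 2)].
    Since [p + (r - 1/2) mu < q], this makes [D^r] square integrable against the
    Student density, which is the finiteness of the constants, and makes [D^n]
    vanish at infinity along the [l]-th axis for every [n < r].

    Hence the coefficient of index [k] can be integrated by parts [r] times in
    the [l]-th variable without boundary terms ([shifted_coef_parts]): each step
    brings out a factor [- 1 / (k_l pi)] and shifts the phase of the [l]-th
    cosine by a quarter period. The squared coefficient is therefore
    [(k_l pi)^(-2r)] times the squared coefficient of [D^r] on a system which,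
    for [k_l >= 1], is still orthonormal ([basis_orthonormal]). Bessel's
    inequality bounds the sum over [k_l > K_l] by [C^(l,r) / (K_l + 1)^(2r)]
    ([coef_bessel]), and a union bound over [l] concludes.

    All these computations take place on the whole space; the cube only appears
    through the change of variables of [integral_student_quantiles], which
    identifies the integral of [|D^r|^2] against the Student density with the
    integral defining [C^(l,r)]. *)

(** * Powers, and calculus on the real line *)

Section powers.
Context {R : realType}.
Implicit Types s t : R.

Lemma is_derive_powR_comp (g : R -> R) (dg s t : R) : 0 < g t ->
  is_derive t 1 g dg ->
  is_derive t 1 (fun t => g t `^ s) (s * g t `^ (s - 1) * dg).
Proof.
move=> g0 Dg.
exact: is_derive1_comp (is_derive1_powR s g0) Dg.
Qed.

Lemma continuous_powR_comp (T : topologicalType) (g : T -> R) (s : R) (x : T) :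
  0 < g x -> {for x, continuous g} ->
  {for x, continuous (fun z => g z `^ s)}.
Proof.
move=> g0 cg; apply: (@continuous_comp _ _ _ g (fun a => powR a s)) => //.
apply: (@differentiable_continuous _ R^o R^o); apply/derivable1_diffP.
by apply: derivable_powR; rewrite in_itv/= g0.
Qed.

Lemma cvgy_powRN s : 0 < s -> (1 + t) `^ (- s) @[t --> +oo] --> (0 : R).
Proof.
move=> s0; apply/cvgrPdist_le => e e0; near=> t.
rewrite sub0r normrN ger0_norm ?powR_ge0//.
have -> : e = (e `^ (- s^-1)) `^ (- s).
  by rewrite -powRrM mulrNN mulVf ?gt_eqF// powRr1// ltW.
have t1 : 0 < 1 + t by rewrite ltr_pwDl//; near: t; exact: nbhs_pinfty_ge.
rewrite powRN [leRHS]powRN lef_pV2 ?posrE ?powR_gt0//.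
apply: ge0_ler_powR; rewrite ?nnegrE ?powR_ge0 ?(ltW s0)//.
  exact: ltW.
apply: (@le_trans _ _ t); last by rewrite lerDr.
by near: t; exact: nbhs_pinfty_ge.
Unshelve. all: by end_near. Qed.

Lemma continuous_mul (T : topologicalType) (f g : T -> R) :
  continuous f -> continuous g -> continuous (fun x => f x * g x).
Proof. by move=> cf cg x; exact: continuousM (cf x) (cg x). Qed.

Lemma continuous_add (T : topologicalType) (f g : T -> R) :
  continuous f -> continuous g -> continuous (fun x => f x + g x).
Proof. by move=> cf cg x; exact: continuousD (cf x) (cg x). Qed.

Lemma jap_gt0 t : 0 < 1 + t ^+ 2.
Proof. by rewrite ltr_pwDl// sqr_ge0. Qed.

(** Powers of [1 + t ^+ 2] (the squared Japanese bracket of [t]) carry all the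
    growth estimates. *)
Lemma is_derive_jap s t :
  is_derive t 1 (fun t => (1 + t ^+ 2) `^ s)
    (s * (1 + t ^+ 2) `^ (s - 1) * (2 * t)).
Proof.
apply: is_derive_powR_comp; first exact: jap_gt0.
apply: is_derive_eq; rewrite /= /GRing.scale/= add0r.
ring.
Qed.

Lemma continuous_jap s : continuous (fun t => (1 + t ^+ 2) `^ s).
Proof.
move=> t; apply/differentiable_continuous/derivable1_diffP.
by case: (is_derive_jap s t).
Qed.

Lemma integrable_jap s : 0 < s ->
  (@lebesgue_measure R).-integrable setT
    (EFin \o (fun t : R => (1 + t ^+ 2) `^ (- (s + 1) / 2))).
Proof.
move=> s0; set w := (X in EFin \o X).
have w0 t : 0 <= w t by exact: powR_ge0.
have cw : continuous w by exact: continuous_jap.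
apply/integrableP; split.
  by apply/measurable_EFinP; exact: continuous_measurable_fun.
under eq_integral do rewrite /= ger0_norm//.
rewrite ge0_symfun_integralT//; last by move=> t; rewrite /w/= sqrrN.
rewrite -set_itvcy lte_mul_pinfty// ?lee_fin//.
(* On the half-line, (1 + t)^2 <= 2 (1 + t^2), so that the integrand is at most
   f, which has the explicit antiderivative F. *)
pose c : R := 2 `^ ((s + 1) / 2).
pose f t : R := c * (1 + t) `^ (- s - 1).
pose F t : R := - (c / s) * (1 + t) `^ (- s).
have dF (t : R) : 0 <= t -> is_derive t 1 F (f t).
  move=> t0.
  have t1 : 0 < 1 + t by rewrite ltr_pwDl.
  have D1 : is_derive t 1 (fun t => 1 + t) (1 : R).
    exact: is_derive_eq
      (is_deriveD (is_derive_cst (1 : R) t 1) (is_derive_id t 1)) (add0r _).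
  have D := is_derive_powR_comp (- s) t1 D1.
  apply: (is_derive_eq (@is_deriveZ _ _ _ _ (- (c / s)) _ _ _ D)).
  rewrite /f /GRing.scale/=; field; exact: lt0r_neq0.
have wf (t : R) : 0 <= t -> w t <= f t.
  move=> t0; rewrite /w /f /c.
  have t1 : 0 < 1 + t by rewrite ltr_pwDl.
  have -> : - s - 1 = 2 * (- (s + 1) / 2) by field.
  rewrite [in leRHS](powRrM _ 2) (powR_mulrn 2) ?(ltW t1)//.
  have -> : (s + 1) / 2 = - (- (s + 1) / 2) by field.
  set a := - (s + 1) / 2.
  rewrite powRN mulrC ler_pdivlMr ?powR_gt0// -powRM//; last exact/ltW/jap_gt0.
  have -> : a = - ((s + 1) / 2) by rewrite /a; field.
  rewrite !powRN lef_pV2 ?posrE ?powR_gt0 ?mulr_gt0 ?jap_gt0 ?exprn_gt0//.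
  apply: ge0_ler_powR;
    rewrite ?nnegrE ?exprn_ge0 ?mulr_ge0 ?(ltW t1) ?(ltW (jap_gt0 _))//.
    by rewrite ?divr_ge0// addr_ge0// ltW.
  by have := sqr_ge0 (1 - t); lra.
have cF : {within `[0, +oo[, continuous f}.
  apply: derivable_within_continuous => t; rewrite in_itv/= andbT => t0.
  have t1 : 0 < 1 + t by rewrite ltr_pwDl.
  have D1 : is_derive t 1 (fun t => 1 + t) (1 : R).
    exact: is_derive_eq
      (is_deriveD (is_derive_cst (1 : R) t 1) (is_derive_id t 1)) (add0r _).
  by apply: derivableM => //; case: (is_derive_powR_comp (- s - 1) t1 D1).
apply: (@le_lt_trans _ _ (\int[lebesgue_measure]_(x in `[0%R, +oo[) (f x)%:E)%E).
  apply: ge0_le_integral => //=.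
  - by move=> t _; rewrite lee_fin.
  - by apply/measurable_EFinP/measurable_funTS; exact: continuous_measurable_fun.
  - by apply/measurable_EFinP; exact: subspace_continuous_measurable_fun.
  - by move=> t; rewrite in_itv/= andbT => t0; rewrite lee_fin wf.
rewrite (@ge0_continuous_FTC2y _ f F 0 0)//.
- by rewrite -EFinB ltry.
- by move=> t t0; rewrite (le_trans (w0 t))// wf.
- rewrite -[X in _ --> X](mulr0 (- (c / s))); apply: cvgMr.
  exact: cvgy_powRN.
- by move=> t t0; case: (dF t (ltW t0)).
- apply: cvg_at_right_filter; apply/differentiable_continuous/derivable1_diffP.
  by case: (dF 0 (lexx _)).
- by move=> t; rewrite in_itv/= andbT => t0; rewrite derive1E; case: (dF t (ltW t0)).
Qed.

Lemma integralT_cvg (f : R -> R) :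
  (@lebesgue_measure R).-integrable setT (EFin \o f) ->
  (\int[lebesgue_measure]_(t in `[- (n%:R), n%:R]) f t)%R @[n --> \oo] -->
    (\int[lebesgue_measure]_t f t)%R.
Proof.
move=> intf; have mf := measurable_int _ intf.
pose g (n : nat) t := ((EFin \o f) \_ `[- (n%:R : R), n%:R]) t.
have [] := @dominated_convergence _ _ _ lebesgue_measure setT measurableT g
  (EFin \o f) (abse \o (EFin \o f)).
- move=> n; apply/measurable_restrict => //=.
  by rewrite setTI; exact: measurable_funTS.
- exact: mf.
- apply/aeW => x _; apply: cvg_near_cst; near=> n.
  rewrite /g patchE mem_set//= in_itv/= -ler_norml.
  by near: n; exact: nbhs_infty_ger.
- exact: integrable_abse.
- apply/aeW => x n _; rewrite /g patchE; case: ifP => _; first by rewrite lexx.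
  by rewrite abse0 abse_ge0.
move=> _ _ cvg.
have fin : (\int[lebesgue_measure]_t (f t)%:E)%E \is a fin_num.
  exact: integrable_fin_num.
rewrite /Rintegral; apply: fine_cvg; rewrite fineK//.
under eq_fun do rewrite integral_mkcond.
exact: cvg.
Unshelve. all: by end_near. Qed.

(** The fundamental theorem of calculus on the whole line, for an integrable
    continuous derivative which may change sign. *)
Lemma integralT_FTC (f F : R -> R) (a b : R) :
  (forall t, is_derive t 1 F (f t)) -> continuous f ->
  (@lebesgue_measure R).-integrable setT (EFin \o f) ->
  F (- n%:R) @[n --> \oo] --> a -> F n%:R @[n --> \oo] --> b ->
  (\int[lebesgue_measure]_t f t)%R = b - a.
Proof.
move=> dF cf intf Fa Fb.
have cF : continuous F.
  move=> t; apply/differentiable_continuous/derivable1_diffP.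
  by case: (dF t).
suff: (\int[lebesgue_measure]_(t in `[- (n%:R), n%:R]) f t)%R @[n --> \oo] --> b - a.
  by apply: cvg_unique (integralT_cvg intf).
apply: cvg_trans (cvgB Fb Fa); apply: near_eq_cvg; near=> n.
have n0 : - n%:R < n%:R :> R.
  by rewrite gtrN// ltr0n; near: n; exists 1%N.
rewrite /Rintegral (@continuous_FTC2 _ f F)//=.
- exact: continuous_subspaceT.
- split => [t _|//|].
  + by case: (dF t).
  + by apply: cvg_at_right_filter; exact: cF.
  + by apply: cvg_at_left_filter; exact: cF.
- by move=> t _; rewrite derive1E; case: (dF t).
Unshelve. all: by end_near. Qed.

End powers.

(** * The Student density, its distribution function and its quantiles *)

Section student_density.
Context {R : realType}.
Variable mu : R.
Hypothesis mu0 : 0 < mu.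
Local Notation leb := (@lebesgue_measure R).
Local Notation nu := (student1 mu).
Local Notation F := (student_cdf mu).
Local Notation Q := (student_quantile mu).

Let w (t : R) := (1 + t ^+ 2) `^ (- (mu + 1) / 2).

Lemma student_cst_gt0 : 0 < student_cst mu.
Proof.
rewrite /student_cst invr_gt0 /Rintegral fine_gt0//; apply/andP; split; last first.
  by have := integrable_fin_num measurableT (integrable_jap mu0);
    rewrite fin_numElt => /andP[].
have mw : measurable_fun setT (EFin \o w).
  by apply/measurable_EFinP; apply: continuous_measurable_fun; exact: continuous_jap.
(* Positivity: on [0, 1], the integrand is at least 2 `^ (- (mu + 1) / 2). *)
apply: (@lt_le_trans _ _ (\int[leb]_(t in `[0%R, 1%R]) (w t)%:E)%E); last first.
  by apply: ge0_subset_integral => //= t _; rewrite lee_fin powR_ge0.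
apply: (@lt_le_trans _ _ (\int[leb]_(t in `[0%R, 1%R]) (2 `^ (- (mu + 1) / 2))%:E)%E).
  rewrite integral_cst//= lebesgue_measure_itv/= lte01 oppr0 adde0 mule1.
  by rewrite lte_fin powR_gt0.
apply: ge0_le_integral => //=.
- exact: measurable_funTS.
- move=> t; rewrite in_itv/= => /andP[t0 t1]; rewrite lee_fin /w mulNr !powRN.
  rewrite lef_pV2 ?posrE ?powR_gt0 ?jap_gt0//.
  apply: ge0_ler_powR; rewrite ?nnegrE ?(ltW (jap_gt0 _))//.
    by rewrite ?divr_ge0// addr_ge0// ltW.
  by rewrite -[leRHS]/(1 + 1) lerD2l expr_le1.
Qed.

Lemma student1_gt0 t : 0 < nu t.
Proof. by rewrite mulr_gt0 ?student_cst_gt0// powR_gt0 ?jap_gt0. Qed.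

Lemma continuous_student1 : continuous nu.
Proof.
move=> t; rewrite /student1; apply: cvgM; first exact: cvg_cst.
exact: continuous_jap.
Qed.

Lemma integrable_student1 : leb.-integrable setT (EFin \o nu).
Proof.
have := integrableZl measurableT (student_cst mu) (integrable_jap mu0).
by apply: eq_integrable => // t _ /=; rewrite EFinM.
Qed.

Lemma integral_student1 : (\int[leb]_t nu t)%R = 1.
Proof.
have fin := integrable_jap mu0.
rewrite /student1 RintegralZl//= /student_cst mulVf//.
by have := student_cst_gt0; rewrite /student_cst invr_gt0 => /lt0r_neq0.
Qed.

Lemma is_derive_student_cdf (x : R) : is_derive x 1 F (nu x).
Proof.
have [] := @continuous_FTC1 R nu -oo%O x (x + 1).
- by rewrite ltrDl.
- exact: integrableS integrable_student1.
- by rewrite ltNyr.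
- exact: continuous_student1.
- by rewrite derive1E => d <-; exact: DeriveDef.
Qed.

Lemma continuous_student_cdf : continuous F.
Proof.
move=> t; apply/differentiable_continuous/derivable1_diffP.
by case: (is_derive_student_cdf t).
Qed.

Lemma student_cdf_lt : {homo F : x y / x < y}.
Proof.
move=> x y xy.
have [|t _ H] := MVT xy (fun t _ => is_derive_student_cdf t).
  exact: continuous_subspaceT continuous_student_cdf.
by rewrite -subr_gt0 H mulr_gt0 ?subr_gt0// student1_gt0.
Qed.

Lemma student_cdf_le : {mono F : x y / x <= y}.
Proof. exact: le_mono student_cdf_lt. Qed.

Lemma student_cdf_itvB x y : x <= y ->
  F y - F x = (\int[leb]_(t in `]x, y]) nu t)%R.
Proof.
move=> xy; rewrite /student_cdf Rintegral_itvB//.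
exact: integrableS integrable_student1.
Qed.

Lemma cvg_student_cdf :
  (F (- n%:R) @[n --> \oo] --> (0 : R)) /\ (F n%:R @[n --> \oo] --> (1 : R)).
Proof.
have Dn n : F n%:R - F (- n%:R) = (\int[leb]_(t in `[(- n%:R)%R, n%:R%R]) nu t)%R.
  rewrite student_cdf_itvB ?Rintegral_itv_obnd_cbnd//.
    exact: integrableS integrable_student1.
  by rewrite (@le_trans _ _ 0)// oppr_le0.
have Dcvg : (F n%:R - F (- n%:R)) @[n --> \oo] --> (1 : R).
  under eq_fun do rewrite Dn.
  by have := integralT_cvg integrable_student1; rewrite integral_student1.
have F0 x : 0 <= F x.
  by apply: Rintegral_ge0 => t _; exact/ltW/student1_gt0.
have F1 x : F x <= 1.
  rewrite -integral_student1 /student_cdf /Rintegral fine_le//.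
  - exact/integrable_fin_num/(integrableS _ _ _ integrable_student1).
  - exact: integrable_fin_num integrable_student1.
  - apply: ge0_subset_integral => //.
      by have /integrableP[] := integrable_student1.
    by move=> t _; rewrite lee_fin; exact/ltW/student1_gt0.
split.
- apply: (@squeeze_cvgr _ _ _ _ (fun=> 0) (fun n => 1 - (F n%:R - F (- n%:R)))).
  + by near=> n; rewrite F0/=; have := F1 n%:R; lra.
  + exact: cvg_cst.
  + rewrite -[X in _ --> X](subrr 1); apply: cvgB => //; exact: cvg_cst.
- apply: (@squeeze_cvgr _ _ _ _ (fun n => F n%:R - F (- n%:R)) (fun=> 1)) => //.
  + by near=> n; rewrite F1 andbT gerBl F0.
  + exact: cvg_cst.
Unshelve. all: by end_near. Qed.

Lemma student_cdf_gt0 x : 0 < F x.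
Proof.
apply: (@le_lt_trans _ _ (F (x - 1))); last by apply: student_cdf_lt; rewrite gtrBl.
by apply: Rintegral_ge0 => t _; exact/ltW/student1_gt0.
Qed.

Lemma student_cdf_lt1 x : F x < 1.
Proof.
have [_ F1] := cvg_student_cdf.
apply: (@lt_le_trans _ _ (F (x + 1))); first by apply: student_cdf_lt; rewrite ltrDl.
rewrite -[leRHS](cvg_lim (@Rhausdorff R) F1).
apply: limr_ge; first exact: cvgP F1.
near=> n; rewrite student_cdf_le; near: n; exact: nbhs_infty_ger.
Unshelve. all: by end_near. Qed.

Lemma student_cdfK : cancel F Q.
Proof.
move=> x; rewrite /student_quantile pinvKV ?inE//.
by move=> a b _ _; exact: (inc_inj student_cdf_le).
Qed.

Lemma student_quantileK u : 0 < u < 1 -> F (Q u) = u.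
Proof.
move=> /andP[u0 u1]; have [c0 c1] := cvg_student_cdf.
suff [x xu] : exists x, F x = u by rewrite -xu student_cdfK.
have [n n1] : exists n : nat, F (- n%:R) < u.
  have /cvgrPdist_lt/(_ _ u0)[n _ H] := c0; exists n.
  by have := H n (leqnn _); rewrite sub0r normrN ger0_norm// ltW// student_cdf_gt0.
have [m m1] : exists m : nat, u < F m%:R.
  have u1' : 0 < 1 - u by rewrite subr_gt0.
  have /cvgrPdist_lt/(_ _ u1')[m _ H] := c1; exists m.
  have := H m (leqnn _); rewrite ger0_norm; first by lra.
  by rewrite subr_ge0 ltW// student_cdf_lt1.
have nm : - n%:R <= m%:R :> R by rewrite (@le_trans _ _ 0)// oppr_le0.
have [||c _ cu] := @IVT R F _ _ u nm.
- exact: continuous_subspaceT continuous_student_cdf.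
- rewrite minElt maxElt (lt_trans n1 m1) (ltW n1) (ltW m1)//.
- by exists c.
Qed.

Lemma is_derive_student_quantile (u : R) : 0 < u < 1 ->
  is_derive u 1 Q (nu (Q u))^-1.
Proof.
move=> u01; rewrite -{1}(student_quantileK u01).
apply: (@is_derive_inverse R F).
- by near=> x; exact: student_cdfK.
- by near=> x; exact: continuous_student_cdf.
- exact: is_derive_student_cdf.
- by rewrite gt_eqF// student1_gt0.
Unshelve. all: by end_near. Qed.

End student_density.

(** * Lebesgue measure on row vectors *)

Section rV_measurability.
Context {R : realType}.

(** The product sigma-algebra contains the open sets: an open set is the union of
    the countably many cubes it contains whose centre is rational and whose
    radius is the inverse of a positive integer. *)
Lemma open_measurable_rV n (U : set 'rV[R]_n) : open U -> measurable U.
Proof.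
move=> oU.
pose box (z : 'rV[rat]_n * nat) : set 'rV[R]_n :=
  [set x | forall l, `|x 0 l - ratr (z.1 0 l)| < z.2.+1%:R^-1].
have mbox z : measurable (box z).
  rewrite (_ : box z = \bigcap_(l in [set: 'I_n])
      (fun x : 'rV[R]_n => x 0 l) @^-1`
        [set t | `|t - ratr (z.1 0 l)| < z.2.+1%:R^-1]); last first.
    by apply/seteqP; split => [x h l _|x h l]; exact: h.
  apply: fin_bigcap_measurable => // l _.
  rewrite -[X in measurable X]setTI; apply: measurable_coord => //.
  rewrite (_ : [set _ | _] = ball (ratr (z.1 0 l) : R) z.2.+1%:R^-1).
    exact: measurable_ball.
  by apply/seteqP; split => t /=; rewrite /ball/= distrC.
pose F z := if `[< box z `<=` U >] then box z else set0.
rewrite (_ : U = \bigcup_z F z); last first.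
  apply/seteqP; split => [x Ux|x [z _]]; last first.
    by rewrite /F; case: asboolP => // /[apply].
  have /nbhs_ballP[e /= e0 eU] : nbhs x U by exact: open_nbhs_nbhs.
  have e20 : 0 < e / 2 by rewrite divr_gt0.
  have [k _ /(_ k (leqnn _))/= ke] := near_infty_natSinv_lt (PosNum e20).
  have k0 : 0 < k.+1%:R^-1 :> R by rewrite invr_gt0.
  have /choice[a ha] : forall l, exists a : rat, `|x 0 l - ratr a| < k.+1%:R^-1.
    move=> l; have [|a] := @rat_in_itvoo R (x 0 l) (x 0 l + k.+1%:R^-1).
      by rewrite ltrDl.
    rewrite in_itv/= => /andP[xa ax]; exists a.
    by rewrite distrC gtr0_norm ?subr_gt0// ltrBlDl.
  exists (\row_l a l, k) => //; rewrite /F asboolT; first by move=> l; rewrite mxE.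
  move=> z hz; apply: eU; split => // i j; rewrite ord1 /ball/=.
  have := hz j; have := ha j; rewrite /= mxE => h1 h2.
  rewrite (_ : x 0 j - z 0 j = (x 0 j - ratr (a j)) - (z 0 j - ratr (a j))).
    rewrite (le_lt_trans (ler_normB _ _))// (lt_trans (ltrD h1 h2))//.
    by rewrite [ltRHS]splitr ltrD.
  by rewrite opprB addrA subrK.
apply: countable_bigcupT_measurable => [|z]; first exact: countableP.
by rewrite /F; case: ifP.
Qed.

Lemma continuous_measurable_rV n (f : 'rV[R]_n -> R) :
  continuous f -> measurable_fun setT f.
Proof.
move=> /continuousP cf; apply: (measurability _ (RGenOpens.measurableE R)) => //.
move=> _ [_ [a [b ->] <-]]; rewrite setTI.
by apply: open_measurable_rV; apply: cf; exact: interval_open.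
Qed.

(** A map into row vectors is continuous as soon as its coordinates are. *)
Lemma continuous_rV (T : topologicalType) n (f : T -> 'rV[R]_n) (x : T) :
  (forall l, f t 0 l @[t --> x] --> f x 0 l) -> f t @[t --> x] --> f x.
Proof.
move=> cf; apply/cvg_ballP => e e0.
have : \forall t \near x, forall l : 'I_n, ball (f x 0 l) e (f t 0 l).
  by apply: filter_forall => l; have /cvg_ballP := cf l; exact.
by apply: filterS => t H; split=> // a b; rewrite ord1.
Qed.

Lemma continuous_cons_rV_l n (v : 'rV[R]_n) : continuous (fun t => cons_rV (t, v)).
Proof.
move=> t; apply: continuous_rV => l; case: (unliftP ord0 l) => [k|] ->.
  rewrite cons_rVS; under eq_fun do rewrite cons_rVS; exact: cvg_cst.
rewrite cons_rV0; under eq_fun do rewrite cons_rV0; exact: cvg_id.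
Qed.

Lemma continuous_cons_rV_r n (t : R) : continuous (fun v : 'rV[R]_n => cons_rV (t, v)).
Proof.
move=> v; apply: continuous_rV => l; case: (unliftP ord0 l) => [k|] ->.
  rewrite cons_rVS; under eq_fun do rewrite cons_rVS; exact: coord_continuous.
rewrite cons_rV0/=; under eq_fun do rewrite cons_rV0/=.
exact: (@cst_continuous _ _ t v).
Qed.

Lemma continuous_prod (T : topologicalType) (I : Type) (r : seq I)
    (f : I -> T -> R) :
  (forall i, continuous (f i)) -> continuous (fun x => \prod_(i <- r) f i x).
Proof.
by move=> cf; apply: continuous_big => //; exact: mul_continuous.
Qed.

(** The row vector obtained by inserting [z.1] at position [l] in [z.2]; it
    generalizes [cons_rV], which is the case [l = ord0]. *)
Definition ins n (l : 'I_n.+1) (z : R * 'rV[R]_n) : 'rV[R]_n.+1 :=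
  \row_j (if unlift l j is Some k then z.2 0 k else z.1).

Lemma ins_id n (l : 'I_n.+1) z : ins l z 0 l = z.1.
Proof. by rewrite mxE unlift_none. Qed.

Lemma ins_lift n (l : 'I_n.+1) z k : ins l z 0 (lift l k) = z.2 0 k.
Proof. by rewrite mxE liftK. Qed.

Lemma ins0 n : @ins n ord0 = @cons_rV R n.
Proof.
apply/funext => z; apply/rowP => j; case: (unliftP ord0 j) => [k|] ->.
  by rewrite ins_lift cons_rVS.
by rewrite ins_id cons_rV0.
Qed.

Lemma ins_cons n (l : 'I_n.+1) (t x0 : R) v :
  ins (lift ord0 l) (t, cons_rV (x0, v)) = cons_rV (x0, ins l (t, v)).
Proof.
apply/rowP => j; case: (unliftP ord0 j) => [k|] ->; last first.
  rewrite cons_rV0/= (_ : ord0 = lift (lift ord0 l) ord0).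
    by rewrite ins_lift/= cons_rV0.
  exact/val_inj.
rewrite cons_rVS/=; case: (unliftP l k) => [k'|] ->; last by rewrite !ins_id.
rewrite ins_lift/= (_ : lift ord0 (lift l k') =
  lift (lift ord0 l) (lift ord0 k')) ?ins_lift/= ?cons_rVS//.
by apply/val_inj; rewrite /= /bump !leq0n !add1n ltnS addnS.
Qed.

Lemma measurable_ins n (l : 'I_n.+1) :
  measurable_fun [set: measurableTypeR R * 'rV[R]_n] (@ins n l).
Proof.
apply: measurable_fun_matrix => i j; rewrite ord1.
case: (unliftP l j) => [k|] ->.
  under eq_fun do rewrite ins_lift.
  exact: (measurableT_comp (measurable_coord 0 k) measurable_snd).
under eq_fun do rewrite ins_id.
exact: measurable_fst.
Qed.

End rV_measurability.

Section rV_integral.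
Context {R : realType}.
Local Notation leb := (@lebesgue_measure R).
Local Open Scope ereal_scope.

Lemma ge0_integral_cons n (f : 'rV[R]_n.+1 -> \bar R) :
  measurable_fun setT f -> (forall x, 0 <= f x) ->
  \int[lebesgue_rV n.+1]_x f x =
  \int[(leb \x lebesgue_rV n)]_z f (cons_rV z).
Proof.
move=> mf f0.
by rewrite -(@ge0_integral_pushforward _ _ (measurableTypeR R * 'rV[R]_n)%type _
  R (@cons_rV R n) (@measurable_cons_rV R n) (leb \x lebesgue_rV n) setT f).
Qed.

(** Tonelli's theorem with an arbitrary coordinate singled out; [lebesgue_rV]
    only singles out the first one. *)
Lemma ge0_integral_ins n (l : 'I_n.+1) (f : 'rV[R]_n.+1 -> \bar R) :
  measurable_fun setT f -> (forall x, 0 <= f x) ->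
  \int[lebesgue_rV n.+1]_x f x =
  \int[(leb \x lebesgue_rV n)]_z f (ins l z).
Proof.
elim: n l f => [|n IH] l f mf f0.
  by rewrite (ord1 l) ins0 ge0_integral_cons.
case: (unliftP ord0 l) => [l'|] ->; last by rewrite ins0 ge0_integral_cons.
have mfc : measurable_fun setT (fun z => f (cons_rV z)).
  exact: measurableT_comp mf (@measurable_cons_rV _ _).
have mfi : measurable_fun setT (fun z => f (ins (lift ord0 l') z)).
  exact: measurableT_comp mf (@measurable_ins _ _ _).
rewrite ge0_integral_cons// fubini_tonelli1//.
transitivity (\int[leb]_x0 \int[lebesgue_rV n]_v \int[leb]_t
    f (ins (lift ord0 l') (t, cons_rV (x0, v)))).
  apply: eq_integral => x0 _; rewrite /fubini_F.
  have mfx : measurable_fun setT (fun v => f (cons_rV (x0, v))).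
    exact: measurableT_comp mfc (measurable_pair1 _).
  rewrite (IH l')// fubini_tonelli1//; last first.
    exact: measurableT_comp mfx (@measurable_ins _ _ _).
  rewrite fubini_tonelli//; last first.
    exact: measurableT_comp mfx (@measurable_ins _ _ _).
  apply: eq_integral => v _; apply: eq_integral => t _.
  by rewrite ins_cons.
have mG := measurable_fun_fubini_tonelli_G (m1 := leb)
  (fun z => f (ins (lift ord0 l') z)) mfi (fun=> f0 _).
rewrite [RHS]fubini_tonelli1// [RHS]fubini_tonelli//.
rewrite ge0_integral_cons; last 2 first.
- exact: mG.
- by move=> v; apply: integral_ge0.
rewrite fubini_tonelli1//; last first.
- by move=> v; apply: integral_ge0.
- exact: measurableT_comp mG (@measurable_cons_rV R n).
Qed.

Lemma integrable_ins n (l : 'I_n.+1) (f : 'rV[R]_n.+1 -> \bar R) :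
  (lebesgue_rV n.+1).-integrable setT f ->
  (leb \x lebesgue_rV n).-integrable setT (f \o ins l).
Proof.
move=> /integrableP[mf fi]; apply/integrableP; split.
  exact: measurableT_comp mf (@measurable_ins _ _ _).
have maf := measurableT_comp (@abse_measurable R setT) mf.
by have <- := ge0_integral_ins l maf (fun=> abse_ge0 _).
Qed.

Lemma integral_ins n (l : 'I_n.+1) (f : 'rV[R]_n.+1 -> \bar R) :
  (lebesgue_rV n.+1).-integrable setT f ->
  \int[lebesgue_rV n.+1]_x f x =
  \int[lebesgue_rV n]_v \int[leb]_t f (ins l (t, v)).
Proof.
move=> intf; have mf := measurable_int _ intf.
have -> : \int[lebesgue_rV n.+1]_x f x =
    \int[(leb \x lebesgue_rV n)]_z (f \o ins l) z.
  rewrite integralE [RHS]integralE.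
  congr (_ - _).
    rewrite (ge0_integral_ins l (measurable_funepos mf) (funepos_ge0 _)).
    by apply: eq_integral => z _; rewrite !funeposE.
  rewrite (ge0_integral_ins l (measurable_funeneg mf) (funeneg_ge0 _)).
    by apply: eq_integral => z _; rewrite !funenegE.
by rewrite -integral21_prod_meas1//; exact: integrable_ins.
Qed.

Lemma integrable_prod2 d1 d2 (T1 : measurableType d1) (T2 : measurableType d2)
  (m1 : {sigma_finite_measure set T1 -> \bar R})
  (m2 : {sigma_finite_measure set T2 -> \bar R}) (f : T1 -> R) (g : T2 -> R) :
  m1.-integrable setT (EFin \o f) -> m2.-integrable setT (EFin \o g) ->
  (m1 \x m2).-integrable setT (fun z => (f z.1 * g z.2)%:E).
Proof.
move=> fi gi; have mf := measurable_int _ fi; have mg := measurable_int _ gi.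
have mfg : measurable_fun setT (fun z : T1 * T2 => (f z.1 * g z.2)%:E).
  apply/measurable_EFinP; apply: measurable_funM.
    by apply: measurableT_comp => //; exact/measurable_EFinP.
  by apply: measurableT_comp => //; exact/measurable_EFinP.
have mag : measurable_fun setT (fun y => `|g y|%:E).
  apply/measurable_EFinP; apply: measurableT_comp => //; exact/measurable_EFinP.
have maf : measurable_fun setT (fun y => `|f y|%:E).
  apply/measurable_EFinP; apply: measurableT_comp => //; exact/measurable_EFinP.
apply/integrable12ltyP => //.
under eq_integral => x _.
  under eq_integral do rewrite /= normrM EFinM.
  rewrite ge0_integralZl//.
  over.
rewrite /= ge0_integralZr//.
- apply: lte_mul_pinfty.
  + exact: integral_ge0.
  + by apply: integrable_fin_num => //; exact: integrable_abse fi.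
  + by have /integrableP[] := gi.
- exact: integral_ge0.
Qed.

Lemma integrable_integral_prod n (g : 'I_n -> R -> R) :
  (forall l, leb.-integrable setT (EFin \o g l)) ->
  (lebesgue_rV n).-integrable setT (fun x => (\prod_(l < n) g l (x 0%R l))%R%:E)
  /\ (\int[lebesgue_rV n]_x (\prod_(l < n) g l (x 0 l)) =
      \prod_(l < n) \int[leb]_t g l t)%R.
Proof.
elim: n g => [|n IH] g gi.
  split.
    under eq_fun do rewrite big_ord0.
    apply/integrableP; split; first exact: measurable_cst.
    by rewrite integral_cst//= diracT mule1 normr1 ltry.
  under eq_Rintegral do rewrite big_ord0.
  rewrite big_ord0 Rintegral_cst// [X in fine X](_ : _ = 1%E) ?mulr1//.
  exact: diracT.
have [Gi GE] := IH _ (fun l => gi (lift ord0 l)).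
pose G (v : 'rV[R]_n) := (\prod_(l < n) g (lift ord0 l) (v 0 l))%R.
pose f (x : 'rV[R]_n.+1) := (\prod_(l < n.+1) g l (x 0 l))%R.
have fE z : f (ins ord0 z) = (g ord0 z.1 * G z.2)%R.
  rewrite /f big_ord_recl ins_id; congr (_ * _)%R.
  by apply: eq_bigr => l _; rewrite ins_lift.
have mf : measurable_fun setT f.
  apply: measurable_prod => l _.
  have mgl : measurable_fun (setT : set R) (g l).
    by have /measurable_int/measurable_EFinP := gi l.
  exact: measurableT_comp mgl (measurable_coord 0%R l).
have fi : (lebesgue_rV n.+1).-integrable setT (EFin \o f).
  apply/integrableP; split; first exact/measurable_EFinP.
  rewrite (ge0_integral_ins ord0)//; last first.
    by apply: measurableT_comp; [exact: abse_measurable|exact/measurable_EFinP].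
  have /integrableP[_] := integrable_prod2 (gi ord0) Gi.
  by under eq_integral do rewrite -fE.
split; first exact: fi.
rewrite /Rintegral (integral_ins ord0 fi) big_ord_recl -GE.
have finG := integrable_fin_num measurableT Gi.
have fing := integrable_fin_num measurableT (gi ord0).
rewrite -[X in _ = (_ * X)%R]/(fine _) -fineM//; congr fine.
rewrite -(fineK fing) -integralZl//; apply: eq_integral => v _.
rewrite fineK// -[RHS]integralZr//=.
by apply: eq_integral => t _; rewrite /= fE -EFinM.
Qed.

(** The quantile function transports the uniform law on [(0, 1)] to the Student
    law, here tested against nonnegative continuous functions. *)
Lemma integral_student_quantile (mu : R) (g : R -> R) : (0 < mu)%R ->
  continuous g -> (forall t, 0 <= g t)%R ->
  \int[leb]_(u in `]0%R, 1%R[) (g (student_quantile mu u))%:E =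
  \int[leb]_t (g t * student1 mu t)%:E.
Proof.
move=> mu0 cg g0.
set F := student_cdf mu; set Q := student_quantile mu.
have cQ : {in `]0%R, 1%R[%classic, continuous Q}.
  move=> u; rewrite inE/= in_itv/= => u01.
  apply/differentiable_continuous/derivable1_diffP.
  by case: (is_derive_student_quantile mu0 u01).
have cgQ : {in `]0%R, 1%R[%classic, continuous (g \o Q)}.
  by move=> u u01; apply: continuous_comp; [exact: cQ|exact: cg].
have mgQ : measurable_fun (`]0%R, 1%R[%classic : set R) (g \o Q).
  apply: open_continuous_measurable_fun; last exact: cgQ.
  exact: interval_open.
have mgn : measurable_fun setT (fun t => (g t * student1 mu t)%:E).
  apply/measurable_EFinP; apply: continuous_measurable_fun => t.
  by apply: cvgM; [exact: cg|exact: continuous_student1].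
(* Both sides are limits of integrals over the compact intervals A n and B n,
   where B n is mapped onto A n by the distribution function. *)
pose A (n : nat) : set R := `[F (- n%:R)%R, F n%:R]%classic.
pose B (n : nat) : set R := `[(- n%:R)%R, n%:R]%classic.
have AU : \bigcup_n A n = `]0%R, 1%R[%classic.
  apply/seteqP; split => [u [n _]|u]; rewrite /A/= !in_itv/=.
    move=> /andP[h1 h2]; rewrite (lt_le_trans (student_cdf_gt0 mu0 _) h1).
    exact: le_lt_trans h2 (student_cdf_lt1 mu0 _).
  move=> u01; have [n _ /(_ n (leqnn _))/= Hn] := nbhs_infty_ger `|Q u|%R.
  exists n => //=; rewrite in_itv/= -(student_quantileK mu0 u01).
  by rewrite !student_cdf_le// -ler_norml.
have BU : \bigcup_n B n = setT.
  apply/seteqP; split => // t _.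
  have [n _ /(_ n (leqnn _))/= Hn] := nbhs_infty_ger `|t|%R.
  by exists n => //; rewrite /B/= in_itv/= -ler_norml.
have nA : {homo A : n m / (n <= m)%N >-> (n <= m)%O}.
  move=> n m nm; apply/subsetPset => u; rewrite /A/= !in_itv/= => /andP[h1 h2].
  rewrite (le_trans _ h1) ?(le_trans h2)// student_cdf_le// ?lerN2 ler_nat//.
have nB : {homo B : n m / (n <= m)%N >-> (n <= m)%O}.
  move=> n m nm; apply/subsetPset => u; rewrite /B/= !in_itv/= => /andP[h1 h2].
  by rewrite (le_trans _ h1) ?(le_trans h2)// ?lerN2 ler_nat.
have A01 n : A n `<=` `]0%R, 1%R[ by rewrite -AU; exact: bigcup_sup.
rewrite -AU -[in RHS]BU.
have cA : \int[leb]_(u in A n) (g (Q u))%:E @[n --> \oo] -->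
    \int[leb]_(u in \bigcup_n A n) (g (Q u))%:E.
  apply: ge0_nondecreasing_set_cvg_integral => //.
  - by move=> n; exact: measurable_itv.
  - by move=> n; apply/measurable_EFinP; exact: measurable_funS mgQ.
  - by move=> n u _; rewrite lee_fin.
have cB : \int[leb]_(t in B n) (g t * student1 mu t)%:E @[n --> \oo] -->
    \int[leb]_(t in \bigcup_n B n) (g t * student1 mu t)%:E.
  apply: ge0_nondecreasing_set_cvg_integral => //.
  - by move=> n; exact: measurable_itv.
  - by move=> n; exact: measurable_funS mgn.
  - by move=> n t _; rewrite lee_fin mulr_ge0// ltW// student1_gt0.
apply: cvg_unique cA _ => //; apply: cvg_trans cB; apply: near_eq_cvg.
apply: nearW => n.
have F'E : F^`()%classic = student1 mu.
  by apply/funext => t; rewrite derive1E; case: (is_derive_student_cdf mu0 t).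
have cn t : {for t, continuous (student1 mu)} by exact: continuous_student1.
rewrite /A (@integration_by_substitution_increasing R F (g \o Q))//.
- apply: eq_integral => t _; rewrite F'E.
  have QF : Q (F t) = t by exact: student_cdfK.
  by rewrite -[RHS]/((g (Q (F t)) * student1 mu t)%:E) QF.
- by rewrite (@le_trans _ _ 0%R)// oppr_le0.
- by move=> x y _ _; exact: student_cdf_lt.
- by rewrite F'E => t _; exact: cn.
- by rewrite F'E; apply: cvgP; apply: cvg_at_right_filter; exact: cn.
- by rewrite F'E; apply: cvgP; apply: cvg_at_left_filter; exact: cn.
- split => [t _||].
  + by case: (is_derive_student_cdf mu0 t).
  + by apply: cvg_at_right_filter; exact: continuous_student_cdf.
  + by apply: cvg_at_left_filter; exact: continuous_student_cdf.
- apply: continuous_in_subspaceT => u uA; apply: cgQ.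
  by rewrite inE; apply: (A01 n); rewrite inE in uA.
Qed.

Lemma measurable_open_cube n : measurable (@open_cube R n).
Proof.
rewrite (_ : open_cube = \bigcap_(l in [set: 'I_n])
    (fun x : 'rV[R]_n => x 0%R l) @^-1` `]0%R, 1%R[); last first.
  apply/seteqP; split => [x h l _|x h l]; rewrite /= ?in_itv/=; first exact: h.
  by have := h l I; rewrite /= in_itv.
apply: fin_bigcap_measurable => // l _.
by rewrite -[X in measurable X]setTI; apply: measurable_coord.
Qed.

Lemma continuous_student (mu : R) n : (0 < mu)%R -> continuous (@student R mu n).
Proof.
move=> mu0; apply: continuous_prod => l x.
apply: (@continuous_comp _ _ _ (fun x : 'rV[R]_n => x 0%R l) (student1 mu)).
  exact: coord_continuous.
exact: continuous_student1.
Qed.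

Lemma student_ge0 (mu : R) n (x : 'rV[R]_n) : (0 < mu)%R -> (0 <= student mu x)%R.
Proof. by move=> mu0; apply: prodr_ge0 => l _; exact/ltW/student1_gt0. Qed.

(** The same for the product laws, by induction on the dimension: the induction
    hypothesis is applied at a fixed first coordinate, and the one-dimensional
    statement after exchanging the integrals, so that continuous functions
    suffice at each step. *)
Lemma integral_student_quantiles (mu : R) n (g : 'rV[R]_n -> R) : (0 < mu)%R ->
  continuous g -> (forall x, 0 <= g x)%R ->
  \int[lebesgue_rV n]_(u in open_cube) (g (student_quantiles mu u))%:E =
  \int[lebesgue_rV n]_x (g x * student mu x)%:E.
Proof.
move=> mu0; elim: n g => [|n IH] g cg g0.
  rewrite (_ : open_cube = setT); last by apply/seteqP; split => // u _ [].
  apply: eq_integral => u _; rewrite /student big_ord0 mulr1.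
  by rewrite [student_quantiles _ _]thinmx0 [u]thinmx0.
pose Q := student_quantile mu.
(* Cutting the quantile function off outside (0, 1) makes it measurable on the
   whole line, without changing the integral over the cube. *)
pose Q' := Q \_ (`]0%R, 1%R[%classic : set R).
have mQ' : measurable_fun (setT : set (measurableTypeR R)) Q'.
  apply/(measurable_restrictT _ _).1 => //.
  apply: open_continuous_measurable_fun; first exact: interval_open.
  move=> u; rewrite inE/= in_itv/= => u01.
  apply/differentiable_continuous/derivable1_diffP.
  by case: (is_derive_student_quantile mu0 u01).
pose Qs k (u : 'rV[R]_k) : 'rV[R]_k := \row_l Q' (u 0%R l).
have mQs k : measurable_fun setT (@Qs k).
  apply: measurable_fun_matrix => i j.
  under eq_fun do rewrite mxE.
  exact: measurableT_comp mQ' (measurable_coord 0%R j).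
have QsE k (u : 'rV[R]_k) : open_cube u -> student_quantiles mu u = Qs k u.
  move=> cu; apply/rowP => l; rewrite !mxE /Q' patchE mem_set//= in_itv/=.
  exact: cu.
have mg : measurable_fun setT g by exact: continuous_measurable_rV.
pose H (u : 'rV[R]_n.+1) := ((EFin \o g \o (@Qs n.+1)) \_ open_cube) u.
have mH : measurable_fun setT H.
  apply/(measurable_restrictT _ _).1; first exact: measurable_open_cube.
  apply: measurable_funTS; apply: measurableT_comp; last exact: mQs.
  exact/measurable_EFinP.
have H0 u : 0 <= H u by rewrite /H patchE; case: ifP => // _; rewrite lee_fin.
transitivity (\int[lebesgue_rV n.+1]_u H u).
  rewrite integral_mkcond; apply: eq_integral => u _; rewrite /H !patchE.
  by case: ifPn => //= uc; rewrite QsE//; exact/set_mem.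
pose K (z : measurableTypeR R * 'rV[R]_n) : \bar R :=
  (\1_(`]0%R, 1%R[%classic : set R) z.1 *
   (g (cons_rV (Q' z.1, z.2)) * student mu z.2))%:E.
have mK : measurable_fun setT K.
  apply/measurable_EFinP; apply: measurable_funM.
    by apply: measurableT_comp measurable_fst; exact: measurable_indic.
  apply: measurable_funM.
    apply: (measurableT_comp mg).
    apply: (measurableT_comp (@measurable_cons_rV R n)).
    apply/measurable_fun_pairP; split => /=.
      exact: measurableT_comp mQ' measurable_fst.
    exact: measurable_snd.
  apply: measurableT_comp measurable_snd; apply: continuous_measurable_rV.
  exact: continuous_student.
have K0 z : 0 <= K z.
  by rewrite lee_fin !mulr_ge0// student_ge0.
rewrite ge0_integral_cons// fubini_tonelli1//; last first.
  exact: measurableT_comp mH (@measurable_cons_rV R n).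
transitivity (\int[leb]_u0 \int[lebesgue_rV n]_v K (u0, v)).
  apply: eq_integral => u0 _; rewrite /fubini_F.
  have [u01|u01] := boolP (u0 \in (`]0%R, 1%R[%classic : set R)); last first.
    rewrite integral0_eq => [|v _]; last first.
      rewrite /H patchE; case: ifPn => // /set_mem cu; exfalso.
      move/negP : u01; apply; rewrite inE/= in_itv/=.
      by have := cu 0%R; rewrite cons_rV0.
    by rewrite integral0_eq// => v _; rewrite /K indicE (negbTE u01) mul0r.
  under [RHS]eq_integral do rewrite /K indicE u01 mul1r/=.
  rewrite -(IH (fun v => g (cons_rV (Q' u0, v)))); last 2 first.
  - move=> v; apply: continuous_comp; first exact: continuous_cons_rV_r.
    exact: cg.
  - by move=> v.
  rewrite [RHS]integral_mkcond; apply: eq_integral => v _; rewrite /H !patchE.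
  have -> : (cons_rV (u0, v) \in open_cube) = (v \in open_cube).
    apply/idP/idP => /set_mem cu; apply/mem_set => l.
      by have := cu (lift ord0 l); rewrite cons_rVS.
    case: (unliftP ord0 l) => [k|] ->; first by rewrite cons_rVS.
    by rewrite cons_rV0/=; move: u01; rewrite inE/= in_itv.
  case: ifPn => // /set_mem vc /=; rewrite (QsE n v vc); congr (g _)%:E.
  apply/rowP => l; rewrite mxE; case: (unliftP ord0 l) => [k|] ->.
    by rewrite !cons_rVS mxE.
  by rewrite !cons_rV0.
rewrite -fubini_tonelli1// fubini_tonelli2//.
pose L (z : measurableTypeR R * 'rV[R]_n) := (g (cons_rV z) * student mu (cons_rV z))%:E.
have mL0 : measurable_fun setT (fun x : 'rV[R]_n.+1 => (g x * student mu x)%:E).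
  apply/measurable_EFinP; apply: continuous_measurable_rV.
  exact: continuous_mul cg (continuous_student mu0).
have mL : measurable_fun setT L.
  exact: measurableT_comp mL0 (@measurable_cons_rV R n).
have L0 z : 0 <= L z by rewrite lee_fin mulr_ge0// student_ge0.
rewrite ge0_integral_cons//; last first.
  by move=> x; rewrite lee_fin mulr_ge0// student_ge0.
rewrite [RHS]fubini_tonelli2//.
apply: eq_integral => v _; rewrite /fubini_G.
pose gv t := (g (cons_rV (t, v)) * student mu v)%R.
transitivity (\int[leb]_(t in `]0%R, 1%R[) (gv (student_quantile mu t))%:E).
  rewrite [RHS]integral_mkcond; apply: eq_integral => t _.
  rewrite /K patchE indicE/= /Q' patchE; case: ifPn => _; rewrite ?mul1r// mul0r//.
rewrite integral_student_quantile//; last 2 first.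
- move=> t; apply: cvgM; last exact: cvg_cst.
  by apply: continuous_comp; [exact: continuous_cons_rV_l|exact: cg].
- by move=> t; rewrite mulr_ge0// student_ge0.
apply: eq_integral => t _; rewrite /L /student big_ord_recl cons_rV0/=.
rewrite -mulrA; congr (_ * _)%:E%R; rewrite mulrC; congr (_ * _)%R.
by apply: eq_bigr => l _; rewrite cons_rVS.
Qed.

End rV_integral.

(** * Bessel's inequality *)

Section bessel.
Context (d : measure_display) (T : measurableType d) (R : realType).
Variable m : {measure set T -> \bar R}.

Lemma Rintegral_sum (I : Type) (s : seq I) (h : I -> T -> R) :
  (forall i, m.-integrable setT (EFin \o h i)) ->
  m.-integrable setT (EFin \o (fun x => \sum_(i <- s) h i x)) /\
  (\int[m]_x (\sum_(i <- s) h i x) = \sum_(i <- s) \int[m]_x h i x)%R.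
Proof.
move=> hi; elim: s => [|i s [IH1 IH2]].
  split.
    apply: (eq_integrable measurableT (cst 0%E)) (integrable0 _ _) => // x _.
    by rewrite /= big_nil.
  under eq_Rintegral do rewrite big_nil.
  by rewrite big_nil Rintegral_cst// mul0r.
split.
  apply: (eq_integrable measurableT
    ((EFin \o h i) \+ (EFin \o (fun x => \sum_(i <- s) h i x)))) => //.
    by move=> x _; rewrite /= big_cons EFinD.
  exact: integrableD.
under eq_Rintegral do rewrite big_cons.
by rewrite RintegralD// IH2 big_cons.
Qed.

(** Bessel's inequality for a finite orthonormal family with respect to a
    weight. *)
Lemma bessel (I : eqType) (s : seq I) (f w : T -> R) (e : I -> T -> R) :
  uniq s -> (forall x, 0 <= w x) ->
  m.-integrable setT (EFin \o (fun x => f x ^+ 2 * w x)) ->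
  (forall i, m.-integrable setT (EFin \o (fun x => f x * e i x * w x))) ->
  (forall i j, m.-integrable setT (EFin \o (fun x => e i x * e j x * w x))) ->
  (forall i j, i \in s -> j \in s -> (\int[m]_x (e i x * e j x * w x) = (i == j)%:R)%R) ->
  \sum_(i <- s) (\int[m]_x (f x * e i x * w x))%R ^+ 2 <=
  (\int[m]_x (f x ^+ 2 * w x))%R.
Proof.
move=> us w0 iff ife iee ort.
pose c i := (\int[m]_x (f x * e i x * w x))%R.
(* The square of f - sum_i c_i e_i is f^2 w + S1 + S2 after multiplication by w. *)
pose S1 x := \sum_(i <- s) (- 2 * c i) * (f x * e i x * w x).
pose S2 x := \sum_(i <- s) \sum_(j <- s) (c i * c j) * (e i x * e j x * w x).
have iZ (a : R) g : m.-integrable setT (EFin \o g) ->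
    m.-integrable setT (EFin \o (fun x => a * g x)).
  by move=> gi; have := integrableZl measurableT a gi; apply: eq_integrable.
have [i1 E1] := @Rintegral_sum _ s (fun i x => (- 2 * c i) * (f x * e i x * w x))
  (fun i => iZ _ _ (ife i)).
have H2 i := @Rintegral_sum _ s (fun j x => (c i * c j) * (e i x * e j x * w x))
  (fun j => iZ _ _ (iee i j)).
have [i2 E2] := @Rintegral_sum _ s
  (fun i x => \sum_(j <- s) (c i * c j) * (e i x * e j x * w x)) (fun i => (H2 i).1).
have E1' : (\int[m]_x S1 x = - 2 * \sum_(i <- s) c i ^+ 2)%R.
  rewrite E1 mulr_sumr; apply: eq_bigr => i _.
  by rewrite RintegralZl// -/(c i) -mulrA expr2.
have E2' : (\int[m]_x S2 x = \sum_(i <- s) c i ^+ 2)%R.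
  rewrite E2 !big_seq; apply: eq_bigr => i is_; rewrite (H2 i).2.
  rewrite (big_rem i)//= RintegralZl// ort// eqxx mulr1 -expr2.
  rewrite big_seq big1 ?addr0// => j js.
  move: (js); rewrite (rem_filter _ us) mem_filter /= => /andP[ji js'].
  by rewrite RintegralZl// ort// eq_sym (negbTE ji) mulr0.
have : 0 <= (\int[m]_x (f x ^+ 2 * w x + (S1 x + S2 x)))%R.
  apply: Rintegral_ge0 => x _.
  rewrite (_ : _ + _ = (f x - \sum_(i <- s) c i * e i x) ^+ 2 * w x).
    by rewrite mulr_ge0// sqr_ge0.
  have -> : S1 x = - 2 * (f x * \sum_(i <- s) c i * e i x) * w x.
    rewrite /S1 !mulr_sumr mulr_suml; apply: eq_bigr => i _; ring.
  have -> : S2 x = (\sum_(i <- s) c i * e i x) ^+ 2 * w x.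
    rewrite /S2 expr2 mulr_suml mulr_suml; apply: eq_bigr => i _.
    rewrite mulr_sumr mulr_suml; apply: eq_bigr => j _; ring.
  ring.
rewrite RintegralD//; last first.
  have := integrableD measurableT i1 i2; apply: eq_integrable => // x _.
rewrite RintegralD// E1' E2' -/(c _).
set a := \sum_(i <- s) _; set b := (\int[m]_x _)%R; lra.
Qed.

End bessel.

(** * The cosine system of the Student law *)

Section cosines.
Context {R : realType}.
Variable mu : R.
Hypothesis mu0 : 0 < mu.
Local Notation leb := (@lebesgue_measure R).
Local Notation nu := (student1 mu).
Local Notation F := (student_cdf mu).

(** The cosine of frequency [m], with phase shifted by [c] quarter periods: up
    to sign, the antiderivatives of the cosine basis are of this form. *)
Definition shifted_cos (c m : nat) (t : R) : R :=
  Num.sqrt 2 * cos (m%:R * pi * F t - c%:R * (pi / 2)).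

Lemma is_derive_phase (a b t : R) : is_derive t 1 (fun t => a * F t - b) (a * nu t).
Proof.
have D := is_deriveZ a (is_derive_student_cdf mu0 t).
by apply: (is_derive_eq (is_deriveB D (is_derive_cst b t 1))); rewrite subr0.
Qed.

Lemma continuous_cos_phase (a b : R) : continuous (fun t => cos (a * F t - b)).
Proof.
move=> t; apply: (@continuous_comp _ _ _ (fun t => a * F t - b) cos).
  2: exact: continuous_cos.
apply/differentiable_continuous/derivable1_diffP.
by case: (is_derive_phase a b t).
Qed.

Lemma is_derive_shifted_cos c m (t : R) :
  is_derive t 1 (shifted_cos c.+1 m) (m%:R * pi * nu t * shifted_cos c m t).
Proof.
have D := is_derive1_comp (is_derive_cos _)
  (is_derive_phase (m%:R * pi) (c.+1%:R * (pi / 2)) t).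
apply: (is_derive_eq (is_deriveZ (Num.sqrt 2) D)).
have -> : m%:R * pi * F t - c.+1%:R * (pi / 2) =
    (m%:R * pi * F t - c%:R * (pi / 2)) - pi / 2 by rewrite -natr1; ring.
rewrite sinBpihalf /shifted_cos /GRing.scale/=; ring.
Qed.

Lemma continuous_shifted_cos c m : continuous (shifted_cos c m).
Proof.
apply: continuous_mul; first exact: cst_continuous.
exact: continuous_cos_phase.
Qed.

Lemma sqrt2_ge1 : 1 <= Num.sqrt 2 :> R.
Proof. by rewrite -[leLHS]sqrtr1 ler_sqrt// ler1n. Qed.

Lemma shifted_cos_bound c m t : `|shifted_cos c m t| <= Num.sqrt 2.
Proof.
rewrite normrM ger0_norm ?sqrtr_ge0// ler_piMr ?sqrtr_ge0//.
by rewrite ler_norml cos_geN1 cos_le1.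
Qed.

Lemma phi1E k : phi1 mu k = if k is 0 then fun=> 1 else shifted_cos 0 k.
Proof.
by case: k => [|k]; apply/funext => t //; rewrite /shifted_cos mul0r subr0.
Qed.

Lemma continuous_phi1 k : continuous (phi1 mu k).
Proof.
rewrite phi1E; case: k => [|k]; last exact: continuous_shifted_cos.
exact: cst_continuous.
Qed.

Lemma phi1_bound k t : `|phi1 mu k t| <= Num.sqrt 2.
Proof.
rewrite phi1E; case: k => [|k]; last exact: shifted_cos_bound.
by rewrite normr1 sqrt2_ge1.
Qed.

Lemma integrable_bounded_mul (g h : R -> R) (M : R) : continuous g ->
  (forall t, `|g t| <= M) -> leb.-integrable setT (EFin \o h) ->
  leb.-integrable setT (EFin \o (fun t => g t * h t)).
Proof.
move=> cg gM hi; have mh := measurable_int _ hi.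
apply: (le_integrable measurableT _ _ (integrableZl measurableT M hi)).
  apply/measurable_EFinP; apply: measurable_funM.
    exact: continuous_measurable_fun.
  exact/measurable_EFinP.
move=> t _; rewrite /= lee_fin !normrM.
apply: ler_wpM2r => //; apply: le_trans (gM t) _.
exact: ler_norm.
Qed.

Lemma integral_cos_phase (a c : nat) : (0 < a)%N ->
  (\int[leb]_t (cos (a%:R * pi * F t - c%:R * pi) * nu t) = 0)%R.
Proof.
move=> a0; have api : (a%:R * pi : R) != 0.
  by rewrite mulf_neq0 ?pnatr_eq0 -?lt0n// gt_eqF// pi_gt0.
pose H t := (a%:R * pi)^-1 * sin (a%:R * pi * F t - c%:R * pi).
have sinnpi (n : nat) : sin (n%:R * pi) = 0 :> R.
  elim: n => [|n IH]; first by rewrite mul0r sin0.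
  by rewrite -natr1 mulrDl mul1r sinDpi IH oppr0.
have [c0 c1] := cvg_student_cdf mu0.
have cH (u : nat -> R) (v : R) : F (u n) @[n --> \oo] --> v ->
    H (u n) @[n --> \oo] --> (a%:R * pi)^-1 * sin (a%:R * pi * v - c%:R * pi).
  move=> Fu; apply: cvgM; first exact: cvg_cst.
  apply: (@cvg_comp _ _ _ (fun n => a%:R * pi * F (u n) - c%:R * pi) sin); last first.
    exact: continuous_sin.
  apply: cvgB; last exact: cvg_cst.
  by apply: cvgM; [exact: cvg_cst|exact: Fu].
have DH (t : R) : is_derive t 1 H (cos (a%:R * pi * F t - c%:R * pi) * nu t).
  have D := is_derive1_comp (is_derive_sin _) (is_derive_phase (a%:R * pi) (c%:R * pi) t).
  apply: (is_derive_eq (is_deriveZ (a%:R * pi)^-1 D)).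
  by rewrite /GRing.scale/=; set A := a%:R * pi in api *; field.
have cc : continuous (fun t => cos (a%:R * pi * F t - c%:R * pi)).
  exact: continuous_cos_phase.
have cf := continuous_mul cc (@continuous_student1 R mu).
have fi : leb.-integrable setT
    (EFin \o (fun t => cos (a%:R * pi * F t - c%:R * pi) * nu t)).
  apply: (integrable_bounded_mul (M := 1)) (integrable_student1 mu0) => //.
  by move=> t; rewrite ler_norml cos_geN1 cos_le1.
rewrite (integralT_FTC DH cf fi (cH _ _ c0) (cH _ _ c1)).
by rewrite mulr0 sub0r sinN sinnpi mulr1 sinB !sinnpi !(mul0r, mulr0, subr0, oppr0).
Qed.

(** The phase is the same in both factors, so their product has phases [0] and
    [c] half periods, for which the integrals vanish. *)
Lemma integral_shifted_cosM c m m' : (0 < m)%N -> (0 < m')%N ->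
  (\int[leb]_t (shifted_cos c m t * shifted_cos c m' t * nu t) = (m == m')%:R)%R.
Proof.
move=> m0 m'0.
wlog mm' : m m' m0 m'0 / (m' <= m)%N.
  move=> W; have [|/ltnW] := leqP m' m; first exact: W.
  move=> /(W _ _ m'0 m0); rewrite eq_sym => <-.
  by apply: eq_Rintegral => t _; rewrite (mulrC (shifted_cos c m t)).
pose C (a b : nat) t := cos (a%:R * pi * F t - b%:R * pi).
have ic a b : leb.-integrable setT (EFin \o (fun t => C a b t * nu t)).
  apply: (integrable_bounded_mul (M := 1)) (integrable_student1 mu0) => [|t].
    exact: continuous_cos_phase.
  by rewrite ler_norml cos_geN1 cos_le1.
transitivity (\int[leb]_t (C (m - m')%N 0%N t * nu t + C (m + m')%N c t * nu t))%R.
  apply: eq_Rintegral => t _; rewrite -mulrDl; congr (_ * _).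
  rewrite /shifted_cos /C.
  set A := m%:R * pi * F t - c%:R * (pi / 2); set B := m'%:R * pi * F t - c%:R * (pi / 2).
  have -> : (m - m')%:R * pi * F t - 0%:R * pi = A - B.
    by rewrite natrB// /A /B; ring.
  have -> : (m + m')%:R * pi * F t - c%:R * pi = A + B.
    by rewrite natrD /A /B; field.
  move: A B => A B; rewrite cosB cosD mulrACA -expr2 sqr_sqrtr//; ring.
rewrite RintegralD// [X in _ + X]integral_cos_phase ?addr0 ?ltn_addr//.
have [->|nm] := eqVneq m m'; last first.
  by rewrite integral_cos_phase// subn_gt0 ltn_neqAle eq_sym nm.
rewrite -[RHS](integral_student1 mu0); apply: eq_Rintegral => t _.
by rewrite /C subnn !mul0r subr0 cos0 mul1r.
Qed.

Lemma integral_phi1M k k' :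
  (\int[leb]_t (phi1 mu k t * phi1 mu k' t * nu t) = (k == k')%:R)%R.
Proof.
have H0 m : (0 < m)%N -> (\int[leb]_t (shifted_cos 0 m t * nu t) = 0)%R.
  move=> m0.
  transitivity (\int[leb]_t (Num.sqrt 2 * (cos (m%:R * pi * F t - 0%:R * pi) * nu t)))%R.
    by apply: eq_Rintegral => t _; rewrite /shifted_cos !mul0r; ring.
  rewrite RintegralZl//; first by rewrite (integral_cos_phase 0 m0) mulr0.
  apply: (integrable_bounded_mul (M := 1)) (integrable_student1 mu0) => [|t].
    exact: continuous_cos_phase.
  by rewrite ler_norml cos_geN1 cos_le1.
rewrite !phi1E; case: k => [|k]; case: k' => [|k'].
- under eq_Rintegral do rewrite !mul1r.
  by rewrite integral_student1.
- by under eq_Rintegral do rewrite mul1r; rewrite H0.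
- by under eq_Rintegral do rewrite mulr1; rewrite H0.
- exact: integral_shifted_cosM.
Qed.

(** Integration by parts against the weight [nu]; the boundary terms vanish
    because [s] does at infinity, whatever the phase. *)
Lemma integral_shifted_cos_parts (s s1 : R -> R) (c m : nat) : (0 < m)%N ->
  (forall t : R, is_derive t 1 s (s1 t * nu t)) -> continuous s1 ->
  leb.-integrable setT (EFin \o (fun t => s t * nu t)) ->
  leb.-integrable setT (EFin \o (fun t => s1 t * nu t)) ->
  s (- n%:R) @[n --> \oo] --> (0 : R) -> s n%:R @[n --> \oo] --> (0 : R) ->
  (\int[leb]_t (s t * shifted_cos c m t * nu t) =
   - (m%:R * pi)^-1 * \int[leb]_t (s1 t * shifted_cos c.+1 m t * nu t))%R.
Proof.
move=> m0 Ds cs1 isn is1 s0 s0'.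
have mpi : (m%:R * pi : R) != 0.
  by rewrite mulf_neq0 ?pnatr_eq0 -?lt0n// gt_eqF// pi_gt0.
have cs : continuous s.
  move=> t; apply/differentiable_continuous/derivable1_diffP.
  by case: (Ds t).
have iA : leb.-integrable setT (EFin \o (fun t => s t * shifted_cos c m t * nu t)).
  have := integrable_bounded_mul (@continuous_shifted_cos c m)
    (shifted_cos_bound c m) isn.
  by apply: eq_integrable => // t _ /=; rewrite mulrA (mulrC (s t)).
have iB : leb.-integrable setT (EFin \o (fun t => s1 t * shifted_cos c.+1 m t * nu t)).
  have := integrable_bounded_mul (@continuous_shifted_cos c.+1 m)
    (shifted_cos_bound c.+1 m) is1.
  by apply: eq_integrable => // t _ /=; rewrite mulrA (mulrC (s1 t)).
have iA' := integrableZl measurableT (m%:R * pi) iA.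
(* f is the derivative of s * shifted_cos c.+1 m, which vanishes at infinity. *)
pose f t := s1 t * shifted_cos c.+1 m t * nu t +
  m%:R * pi * (s t * shifted_cos c m t * nu t).
have Df (t : R) : is_derive t 1 (fun t => s t * shifted_cos c.+1 m t) (f t).
  apply: (is_derive_eq (is_deriveM (Ds t) (is_derive_shifted_cos c m t))).
  rewrite /f /GRing.scale/=; ring.
have cvg0 (u : nat -> R) : s (u n) @[n --> \oo] --> (0 : R) ->
    s (u n) * shifted_cos c.+1 m (u n) @[n --> \oo] --> (0 : R).
  move=> su; apply/cvgr0Pnorm_le => e e0.
  have e1 : 0 < e / Num.sqrt 2 by rewrite divr_gt0// sqrtr_gt0.
  have /cvgr0Pnorm_le/(_ _ e1) := su; apply: filterS => n sn.
  rewrite normrM (le_trans (ler_pM _ _ sn (shifted_cos_bound _ _ _)))//.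
  by rewrite divfK// gt_eqF// sqrtr_gt0.
have cf : continuous f.
  apply: continuous_add.
    exact: continuous_mul (continuous_mul cs1 (@continuous_shifted_cos _ _))
      (@continuous_student1 R mu).
  apply: continuous_mul; first exact: cst_continuous.
  exact: continuous_mul (continuous_mul cs (@continuous_shifted_cos _ _))
    (@continuous_student1 R mu).
have := @integralT_FTC R f _ 0 0 Df cf _ (cvg0 _ s0) (cvg0 _ s0').
rewrite subrr /f RintegralD// RintegralZl// => H.
have /H : leb.-integrable setT (EFin \o f).
  have := integrableD measurableT iB iA'.
  by apply: eq_integrable => // t _ /=; rewrite EFinD EFinM.
set a := (\int[leb]_t _)%R; set b := (\int[leb]_t _)%R => ab.
have -> : b = - (m%:R * pi)^-1 * - (m%:R * pi * b) by rewrite mulrNN mulKf.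
by congr (_ * _); lra.
Qed.

End cosines.

(** * Derivatives transported to the cube, and their growth *)

Section slices.
Context {R : realType} {V : normedModType R}.
Implicit Types (f : V -> R) (x v : V).

Lemma slice_quotient f x v (h : R) :
  h^-1 *: (f (h *: v + x) - f x) =
  h^-1 *: (f ((h *: (1 : R) + 0) *: v + x) - f (0 *: v + x)).
Proof. by rewrite addr0 scale0r add0r /GRing.scale/= mulr1. Qed.

(** A directional derivative is the derivative at [0] of a function of one real
    variable. *)
Lemma is_derive_slice f x v (df : R) :
  is_derive x v f df <-> is_derive (0 : R) (1 : R) (fun t : R => f (t *: v + x)) df.
Proof.
have E : (fun h : R => h^-1 *: (f (h *: v + x) - f x)) =
    (fun h => h^-1 *: (f ((h *: (1 : R) + 0) *: v + x) - f (0 *: v + x))).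
  by apply/funext => h; exact: slice_quotient.
split=> -[D1 D2]; apply: DeriveDef.
- by move: D1; rewrite /derivable E.
- by move: D2; rewrite /derive E.
- by move: D1; rewrite /derivable -E.
- by move: D2; rewrite /derive -E.
Qed.

Lemma is_derive_comp_real (g : R -> R) f x v (a b : R) :
  is_derive (f x) (1 : R) g a -> is_derive x v f b ->
  is_derive x v (fun z => g (f z)) (a * b).
Proof.
move=> Dg /is_derive_slice Df; apply/is_derive_slice.
apply: (@is_derive1_comp R g (fun t => f (t *: v + x))) => //.
by rewrite scale0r add0r.
Qed.

Lemma is_derive_mulr f g x v (df dg : R) :
  is_derive x v f df -> is_derive x v g dg ->
  is_derive x v (fun z => f z * g z) (f x * dg + g x * df).
Proof. by move=> Df Dg; exact: is_deriveM. Qed.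

End slices.

Section coordinates.
Context {R : realType} {d : nat}.
Implicit Types (x : 'rV[R]_d) (l j : 'I_d).
Local Notation e_ l := (delta_mx 0 l : 'rV[R]_d).

Lemma is_derive_coord x l j :
  is_derive x (e_ l) (fun z : 'rV[R]_d => z 0 j) ((j == l)%:R : R).
Proof.
apply/is_derive_slice.
have -> : (fun t : R => (t *: e_ l + x) 0 j) = (fun t => t * (j == l)%:R + x 0 j).
  by apply/funext => t; rewrite !mxE eqxx.
apply: is_derive_eq; rewrite addr0 /GRing.scale/=.
by rewrite mulr0 mulr1 add0r.
Qed.

Lemma is_derive_exp (a : nat) (t : R) :
  is_derive t 1 (fun t : R => t ^+ a) (a%:R * t ^+ a.-1).
Proof.
elim: a => [|a IH]; first by rewrite mul0r; exact: is_derive_cst.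
have -> : (fun t : R => t ^+ a.+1) = (fun t => t * t ^+ a).
  by apply/funext => u; rewrite exprS.
apply: (is_derive_eq (is_derive_mulr (is_derive_id t 1) IH)).
by case: a {IH} => [|a]; rewrite -?natr1 /= ?exprS; ring.
Qed.

Lemma enorm_sqr x : enorm x ^+ 2 = \sum_(j < d) x 0 j ^+ 2.
Proof. by rewrite sqr_sqrtr// sumr_ge0// => j _; rewrite sqr_ge0. Qed.

Lemma coord_enorm x l : x 0 l ^+ 2 <= enorm x ^+ 2.
Proof.
rewrite enorm_sqr (bigD1 l)//= lerDl sumr_ge0// => j _.
by rewrite sqr_ge0.
Qed.

Lemma is_derive_enorm_sqr x l :
  is_derive x (e_ l) (fun z : 'rV[R]_d => enorm z ^+ 2) (2 * x 0 l).
Proof.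
apply/is_derive_slice.
have -> : (fun t : R => enorm (t *: e_ l + x) ^+ 2) =
    (fun t => t ^+ 2 + 2 * x 0 l * t + enorm x ^+ 2).
  apply/funext => t; rewrite !enorm_sqr (bigD1 l)//= [in RHS](bigD1 l)//= addrA.
  congr (_ + _); first by rewrite !mxE !eqxx/=; ring.
  by apply: eq_bigr => j jl; rewrite !mxE (negbTE jl) andbF mulr0 add0r.
apply: is_derive_eq; rewrite /GRing.scale/=.
ring.
Qed.

Lemma exp_continuous (T : topologicalType) (f : T -> R) (n : nat) (x : T) :
  {for x, continuous f} -> {for x, continuous (fun z => f z ^+ n)}.
Proof.
move=> cf; elim: n => [|n IH]; first exact: cst_continuous.
rewrite (_ : (fun z => _) = (fun z => f z * f z ^+ n)).
  exact: continuousM cf IH.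
by apply/funext => z; rewrite exprS.
Qed.

Lemma continuous_enorm_sqr : continuous (fun z : 'rV[R]_d => enorm z ^+ 2).
Proof.
under eq_fun do rewrite enorm_sqr.
apply: continuous_big => [|j _ x]; first exact: add_continuous.
by apply: exp_continuous; exact: coord_continuous.
Qed.

End coordinates.

Section weighted_derivatives.
Context {R : realType} {d : nat}.
Variables (mu q : R) (y : 'rV[R]_d -> R) (r p : nat) (l : 'I_d).
Hypothesis mu0 : 0 < mu.
Hypothesis yC : coordinatewise_C r setT y.
Hypothesis growth : forall k, (k <= r)%N -> exists C : R, forall x,
  `|partialn l k y x| <= C * (1 + enorm x ^+ 2) `^ ((p%:R - k%:R) / 2).
Local Notation e_l := (delta_mx 0 l : 'rV[R]_d).
Implicit Types (x : 'rV[R]_d).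

(** The elementary terms of the weighted derivatives. *)
Definition dmono (a : nat) (s t : R) (k : nat) (c : R) x : R :=
  c * x 0 l ^+ a * (1 + x 0 l ^+ 2) `^ s * (1 + enorm x ^+ 2) `^ t *
  partialn l k y x.

(** The sums of elementary terms that occur in the [n]-th weighted derivative.
    The exponents of a term have order at most [n * mu - q] in total, and at most
    [- q] for its factors that depend on all the coordinates of [x]; the order of
    ['D_l^k y] is counted as [- k], and the growth of [y] itself is left out. *)
Inductive dterm (n : nat) : ('rV[R]_d -> R) -> Prop :=
| DTerm0 : dterm n (fun=> 0)
| DTermM a s t k c : (k <= n)%N -> 2 * t - k%:R <= - q ->
    a%:R + 2 * s + 2 * t - k%:R <= n%:R * mu - q -> dterm n (dmono a s t k c)
| DTermD f g : dterm n f -> dterm n g -> dterm n (fun x => f x + g x).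

Let jx_gt0 x : 0 < 1 + x 0 l ^+ 2.
Proof. exact: jap_gt0. Qed.

Let jE_gt0 x : 0 < 1 + enorm x ^+ 2.
Proof. exact: jap_gt0. Qed.

Lemma dterm_continuous n f : (n <= r)%N -> dterm n f -> continuous f.
Proof.
move=> nr; elim=> [|a s t k c kn _ _|g h _ cg _ ch] x.
- exact: cst_continuous.
- have cc : {for x, continuous (fun z : 'rV[R]_d => z 0 l)} by exact: coord_continuous.
  have cxa b : {for x, continuous (fun z : 'rV[R]_d => z 0 l ^+ b)}.
    exact: exp_continuous.
  have cjx : {for x, continuous (fun z : 'rV[R]_d => (1 + z 0 l ^+ 2) `^ s)}.
    apply: (@continuous_powR_comp _ _ (fun z : 'rV[R]_d => 1 + z 0 l ^+ 2)) => //.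
    apply: continuousD; first exact: cst_continuous.
    exact: (cxa 2).
  have cjE : {for x, continuous (fun z : 'rV[R]_d => (1 + enorm z ^+ 2) `^ t)}.
    apply: (@continuous_powR_comp _ _ (fun z : 'rV[R]_d => 1 + enorm z ^+ 2)) => //.
    apply: continuousD; first exact: cst_continuous.
    exact: continuous_enorm_sqr.
  have cy : {for x, continuous (partialn l k y)}.
    by have [_ H] := yC l; apply: H => //; exact: leq_trans kn nr.
  have cc0 : {for x, continuous (fun _ : 'rV[R]_d => c)} by exact: cst_continuous.
  exact: continuousM (continuousM (continuousM (continuousM cc0 (cxa a)) cjx) cjE) cy.
- exact: continuousD (cg x) (ch x).
Qed.

Lemma dterm_bound n f : (n <= r)%N -> dterm n f -> exists C : R, 0 <= C /\ forall x,
  `|f x| <= C * (1 + x 0 l ^+ 2) `^ (n%:R * mu / 2) *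
            (1 + enorm x ^+ 2) `^ ((p%:R - q) / 2).
Proof.
move=> nr; elim=> [|a s t k c kn h1 h2|g h _ [C [C0 HC]] _ [D [D0 HD]]].
- by exists 0; split => // x; rewrite normr0 !mul0r.
- have [C HC] := growth (leq_trans kn nr).
  have C0 : 0 <= C.
    have := le_trans (normr_ge0 _) (HC 0).
    by rewrite pmulr_lge0// powR_gt0.
  exists (`|c| * C); split; first by rewrite mulr_ge0.
  move=> x; have A1 : 1 <= 1 + x 0 l ^+ 2 by rewrite lerDl sqr_ge0.
  have AB : 1 + x 0 l ^+ 2 <= 1 + enorm x ^+ 2 by rewrite lerD2l coord_enorm.
  have A0 := jx_gt0 x; have B0 := jE_gt0 x.
  rewrite /dmono; set A := 1 + x 0 l ^+ 2 in A1 AB A0 *.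
  set B := 1 + enorm x ^+ 2 in AB B0 *.
  rewrite !normrM (ger0_norm (powR_ge0 A s)) (ger0_norm (powR_ge0 B t)).
  have xa : `|x 0 l ^+ a| <= A `^ (a%:R / 2).
    rewrite normrX -[leLHS]powR_mulrn// -[X in X `^ _ <= _]sqrtr_sqr.
    rewrite -powR12_sqrt ?sqr_ge0// -powRrM mulrC.
    apply: ge0_ler_powR; rewrite ?nnegrE ?sqr_ge0 ?(ltW A0)//.
    by rewrite /A lerDr.
  apply: (@le_trans _ _ (`|c| * A `^ (a%:R / 2) * A `^ s * B `^ t *
     (C * B `^ ((p%:R - k%:R) / 2)))).
    apply: ler_pM => //; first by rewrite !mulr_ge0 ?powR_ge0.
    do 2 (apply: ler_wpM2r; first exact: powR_ge0).
    exact: ler_wpM2l.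
  have -> : `|c| * A `^ (a%:R / 2) * A `^ s * B `^ t * (C * B `^ ((p%:R - k%:R) / 2))
     = `|c| * C * (A `^ (a%:R / 2) * A `^ s) * (B `^ t * B `^ ((p%:R - k%:R) / 2)).
    ring.
  have pD (X u v : R) : 0 < X -> X `^ u * X `^ v = X `^ (u + v).
    by move=> X0; rewrite powRD// (gt_eqF X0) implybT.
  set ex := n%:R * mu / 2.
  rewrite !pD// -!mulrA; do 2 apply: ler_wpM2l => //.
  set al := a%:R / 2 + s; set be := t + (p%:R - k%:R) / 2.
  (* The excess de of decay in |x| is traded for decay in x_l, as A <= B. *)
  pose de := (p%:R - q) / 2 - be.
  have de0 : 0 <= de by rewrite /de /be; lra.
  have -> : be = - de + (p%:R - q) / 2 by rewrite /de; lra.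
  rewrite -(pD B (- de) _ B0) mulrA; apply: ler_wpM2r; first exact: powR_ge0.
  apply: (@le_trans _ _ (A `^ al * A `^ (- de))).
    apply: ler_wpM2l; first exact: powR_ge0.
    rewrite !powRN lef_pV2 ?posrE ?powR_gt0//.
    by apply: ge0_ler_powR => //; rewrite nnegrE ltW.
  rewrite pD//; apply: ler_powR => //; rewrite /ex /al /de /be; lra.
- exists (C + D); split; first exact: addr_ge0.
  move=> x; rewrite -!mulrA mulrDl !mulrA.
  by rewrite (le_trans (ler_normD _ _))// lerD.
Qed.

(** The weighted derivative of a sum of terms is again such a sum: dividing by
    the density raises the order by [mu + 1] and differentiating lowers it
    by [1]. *)
Lemma dterm_derive n f : (n < r)%N -> dterm n f ->
  exists g, dterm n.+1 g /\
    forall x, is_derive x e_l f (g x * student1 mu (x 0 l)).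
Proof.
move=> nr; elim=> [|a s t k c kn h1 h2|g h _ [Dg [tg HDg]] _ [Dh [th HDh]]].
- exists (fun=> 0); split; first exact: DTerm0.
  by move=> x; rewrite mul0r; exact: is_derive_cst.
- have k0 := student_cst_gt0 mu0; set ka := student_cst mu in k0.
  pose hh := (mu + 1) / 2.
  pose M1 := dmono a.-1 (s + hh) t k (c * a%:R / ka).
  pose M2 := dmono a.+1 (s - 1 + hh) t k (2 * c * s / ka).
  pose M3 := dmono a.+1 (s + hh) (t - 1) k (2 * c * t / ka).
  pose M4 := dmono a (s + hh) t k.+1 (c / ka).
  exists (fun x => M1 x + M2 x + M3 x + M4 x); split.
    have nS : n.+1%:R = n%:R + 1 :> R by rewrite -natr1.
    have aS : a.+1%:R = a%:R + 1 :> R by rewrite -natr1.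
    have kS : k.+1%:R = k%:R + 1 :> R by rewrite -natr1.
    apply: (@DTermD _ (fun x => M1 x + M2 x + M3 x) M4).
      apply: (@DTermD _ (fun x => M1 x + M2 x) M3).
        apply: (@DTermD _ M1 M2).
    + (* for a = 0, the exponent a.-1 is still 0, but the coefficient vanishes *)
      rewrite /M1; case: a h2 {M1 M2 M3 M4 aS} => [|a] h2.
        rewrite (_ : dmono _ _ _ _ _ = fun=> 0); first exact: DTerm0.
        by apply/funext => x; rewrite /dmono mulr0 !mul0r.
      apply: DTermM => //; first exact: leqW.
      by move: h2; rewrite nS -natr1/= /hh; lra.
    + apply: DTermM => //; first exact: leqW.
      by move: h2; rewrite nS aS /hh; lra.
    + apply: DTermM; first exact: leqW.
        by move: h1; lra.
      by move: h2; rewrite nS aS /hh; lra.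
    + apply: DTermM => //; first by move: h1; rewrite kS; lra.
      by move: h2; rewrite nS kS /hh; lra.
  move=> x.
  have Dc := is_derive_coord x l l; rewrite eqxx in Dc.
  have Da : is_derive x e_l (fun z : 'rV[R]_d => z 0 l ^+ a) (a%:R * x 0 l ^+ a.-1 * 1).
    have De : is_derive (x 0 l) 1 (fun t : R => t ^+ a) (a%:R * x 0 l ^+ a.-1).
      exact: is_derive_exp.
    exact: (is_derive_comp_real (g := fun t => t ^+ a) De Dc).
  have Djx : is_derive x e_l (fun z : 'rV[R]_d => (1 + z 0 l ^+ 2) `^ s)
      (s * (1 + x 0 l ^+ 2) `^ (s - 1) * (2 * x 0 l) * 1).
    exact: (is_derive_comp_real (g := fun t => (1 + t ^+ 2) `^ s)
      (is_derive_jap s (x 0 l)) Dc).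
  have DE : is_derive x e_l (fun z : 'rV[R]_d => (1 + enorm z ^+ 2) `^ t)
      (t * (1 + enorm x ^+ 2) `^ (t - 1) * (2 * x 0 l)).
    apply: (is_derive_comp_real (g := fun u => u `^ t)).
      exact: is_derive1_powR.
    rewrite -[X in is_derive _ _ _ X]add0r.
    exact: is_deriveD (is_derive_cst _ _ _) (is_derive_enorm_sqr x l).
  have Dy : is_derive x e_l (partialn l k y) (partialn l k.+1 y x).
    have [H _] := yC l; have := H k (leq_ltn_trans kn nr) x I.
    by move/derivableP.
  have D := is_derive_mulr (is_derive_mulr (is_derive_mulr
    (is_derive_mulr (is_derive_cst c x e_l) Da) Djx) DE) Dy.
  apply: (is_derive_eq D).
  rewrite /M1 /M2 /M3 /M4 /dmono /student1 -/ka /cst.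
  have A0 := jx_gt0 x; set A := 1 + x 0 l ^+ 2 in A0 *.
  set B := 1 + enorm x ^+ 2.
  have E u : A `^ (u + hh) * A `^ (- (mu + 1) / 2) = A `^ u.
    rewrite -powRD ?(gt_eqF A0) ?implybT// /hh; congr (_ `^ _); lra.
  set P := A `^ (- (mu + 1) / 2) in E *.
  rewrite -(E (s - 1)) -(E s).
  rewrite !exprS; field.
  by rewrite gt_eqF.
- exists (fun x => Dg x + Dh x); split; first exact: DTermD.
  by move=> x; rewrite mulrDl; exact: is_deriveD.
Qed.

(** The weighted derivatives of the damped function: composed with the
    quantiles, the [n]-th one is the [n]-th pure partial derivative of the
    function on the cube, see [partialn_damped_cube]. *)
Definition wderiv (n : nat) : 'rV[R]_d -> R :=
  iter n (fun (g : 'rV[R]_d -> R) x => 'D_(e_l) g x / student1 mu (x 0 l)) (damped q y).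

Lemma dterm_wderiv n : (n <= r)%N -> dterm n (wderiv n).
Proof.
elim: n => [|n IH] nr.
  rewrite (_ : wderiv 0 = dmono 0 0 (- q / 2) 0 1); last first.
    apply/funext => x; rewrite /wderiv/= /damped /dmono expr0 powRr0 mulr1 mul1r mul1r.
    by rewrite mulNr powRN mulrC.
  by apply: DTermM => //; lra.
have [g [tg Dg]] := dterm_derive nr (IH (ltnW nr)).
rewrite (_ : wderiv n.+1 = g)//; apply/funext => x.
rewrite /wderiv iterS -/(wderiv n); have [_ ->] := Dg x.
by rewrite mulfK// gt_eqF// student1_gt0.
Qed.

Lemma is_derive_wderiv n x : (n < r)%N ->
  is_derive x e_l (wderiv n) (wderiv n.+1 x * student1 mu (x 0 l)).
Proof.
move=> nr; have [g [tg Dg]] := dterm_derive nr (dterm_wderiv (ltnW nr)).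
apply: (is_derive_eq (Dg x)); congr (_ * _).
rewrite /wderiv iterS -/(wderiv n); have [_ ->] := Dg x.
by rewrite mulfK// gt_eqF// student1_gt0.
Qed.

Lemma continuous_wderiv n : (n <= r)%N -> continuous (wderiv n).
Proof. by move=> nr; exact: dterm_continuous (dterm_wderiv nr). Qed.

Lemma wderiv_bound n : (n <= r)%N -> exists C : R, 0 <= C /\ forall x,
  `|wderiv n x| <= C * (1 + x 0 l ^+ 2) `^ (n%:R * mu / 2) *
            (1 + enorm x ^+ 2) `^ ((p%:R - q) / 2).
Proof. by move=> nr; exact: dterm_bound (dterm_wderiv nr). Qed.

Lemma open_cube_near (u : 'rV[R]_d) : open_cube u -> \forall v \near u, open_cube v.
Proof.
move=> cu; suff : \forall v \near u, forall j : 'I_d, 0 < (v : 'rV[R]_d) 0 j < 1 by [].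
pose P (j : 'I_d) (v : 'rV[R]_d) : Prop := 0 < v 0 j < 1.
suff H j : \forall v \near u, P j v.
  exact: (@filter_forall _ _ P (nbhs u) (nbhs_filter u) H).
have /andP[u0 u1] := cu j.
have cj : (fun v : 'rV[R]_d => v 0 j) v @[v --> u] --> u 0 j by exact: coord_continuous.
have H0 := cvgr_gt _ cj _ u0; have H1 := cvgr_lt _ cj _ u1.
by near=> v; apply/andP; split; near: v; [exact: H0|exact: H1].
Unshelve. all: by end_near. Qed.

Let Q := student_quantile mu.

Lemma continuous_student_quantiles (u : 'rV[R]_d) : open_cube u ->
  {for u, continuous (@student_quantiles R mu d)}.
Proof.
move=> cu; apply: continuous_rV => j; rewrite mxE; under eq_fun do rewrite mxE.
apply: (@continuous_comp _ _ _ (fun v : 'rV[R]_d => v 0 j) Q).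
  exact: coord_continuous.
apply/differentiable_continuous/derivable1_diffP.
by case: (is_derive_student_quantile mu0 (cu j)).
Qed.

Lemma is_derive_quantiles n (u : 'rV[R]_d) : (n < r)%N -> open_cube u ->
  is_derive u e_l (fun v => wderiv n (student_quantiles mu v))
    (wderiv n.+1 (student_quantiles mu u)).
Proof.
move=> nr cu; set x := student_quantiles mu u.
apply/is_derive_slice.
(* Along the l-th axis of the cube, the quantiles only move by tau along the
   l-th axis of the space. *)
pose tau (t : R) := Q (t + u 0 l) - Q (u 0 l).
have -> : (fun t : R => wderiv n (student_quantiles mu (t *: e_l + u))) =
    (fun t => wderiv n (tau t *: e_l + x)).
  apply/funext => t; congr wderiv; apply/rowP => j; rewrite !mxE eqxx/=.
  have [->|jl] := eqVneq j l; first by rewrite !mulr1 /tau subrK.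
  by rewrite !mulr0 !add0r.
have Dtau : is_derive (0 : R) 1 tau (student1 mu (x 0 l))^-1.
  rewrite -[X in is_derive _ _ _ X]subr0; apply: is_deriveB.
  rewrite -[X in is_derive _ _ _ X]mulr1.
  apply: (@is_derive1_comp R Q (fun t => t + u 0 l)).
    rewrite add0r /x mxE; exact: is_derive_student_quantile.
  rewrite -[X in is_derive _ _ _ X]addr0.
  exact: is_deriveD (is_derive_id _ _) (is_derive_cst _ _ _).
have /is_derive_slice Dw := is_derive_wderiv x nr.
have := @is_derive1_comp R (fun t => wderiv n (t *: e_l + x)) tau 0 _ _ _ Dtau.
rewrite /tau add0r subrr => /(_ _ Dw).
by rewrite mulfK// gt_eqF// student1_gt0.
Qed.

Lemma partialn_damped_cube n (u : 'rV[R]_d) : (n <= r)%N -> open_cube u ->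
  partialn l n (damped_cube mu q y) u = wderiv n (student_quantiles mu u).
Proof.
elim: n u => [//|n IH] u nr cu.
have [_ <-] := is_derive_quantiles nr cu.
rewrite /partialn iterS -/(partialn l n _); apply: near_eq_derive.
by apply: filterS (open_cube_near cu) => v cv; exact: IH (ltnW nr) cv.
Qed.

Lemma damped_cube_derivable n (u : 'rV[R]_d) : (n < r)%N -> open_cube u ->
  derivable (partialn l n (damped_cube mu q y)) u e_l.
Proof.
move=> nr cu; have [D _] := is_derive_quantiles nr cu.
apply: near_eq_derivable D.
apply: filterS (open_cube_near cu) => v cv.
by rewrite partialn_damped_cube// ltnW.
Qed.

Lemma damped_cube_continuous n (u : 'rV[R]_d) : (n <= r)%N -> open_cube u ->
  {for u, continuous (partialn l n (damped_cube mu q y))}.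
Proof.
move=> nr cu.
have c : {for u, continuous (fun v => wderiv n (student_quantiles mu v))}.
  apply: continuous_comp; first exact: continuous_student_quantiles.
  exact: continuous_wderiv.
rewrite /prop_for /continuous_at partialn_damped_cube//.
apply: cvg_trans c.
have H : {near u, (fun v => wderiv n (student_quantiles mu v)) =1
    partialn l n (damped_cube mu q y)}.
  by apply: filterS (open_cube_near cu) => v cv; rewrite partialn_damped_cube.
exact: near_eq_cvg H.
Qed.

End weighted_derivatives.

Section growth.
Context {R : realType} {d : nat}.

Lemma enorm_ge0 (x : 'rV[R]_d) : 0 <= enorm x.
Proof. exact: sqrtr_ge0. Qed.

Lemma compact_enorm_le (M : R) : compact [set x : 'rV[R]_d | enorm x ^+ 2 <= M].
Proof.
apply: bounded_closed_compact.
  exists (1 + M); split; first exact: num_real.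
  move=> K MK x /= xM; rewrite [leLHS]mx_normrE.
  have M0 : 0 <= M by rewrite (le_trans _ xM)// sqr_ge0.
  apply/bigmax_leP; split => [|ij _]; first by lra.
  have := le_trans (coord_enorm x ij.2) xM; rewrite (ord1 ij.1) => h.
  have : `|x 0 ij.2| ^+ 2 <= M by rewrite -normrX ger0_norm// sqr_ge0.
  have := sqr_ge0 (`|x 0 ij.2| - 1); have := normr_ge0 (x 0 ij.2).
  move: (`|x 0 ij.2|) => w w0 w1 w2; nra.
apply: (@closed_comp _ _ (fun x : 'rV[R]_d => enorm x ^+ 2) [set t | t <= M]).
  by move=> x _; exact: continuous_enorm_sqr.
exact: closed_le.
Qed.

(** A growth rate at infinity and continuity give a bound on the whole space. *)
Lemma limf_esup_growth (f : 'rV[R]_d -> R) (z : int) : continuous f ->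
  (limf_esup (fun x => (`|f x| / enorm x ^ z)%:E) enorm_pinfty < +oo)%E ->
  exists C : R, forall x, `|f x| <= C * (1 + enorm x ^+ 2) `^ (z%:~R / 2).
Proof.
move=> cf.
rewrite /limf_esup => /ereal_inf_lt[_ /= [A [M _ MA] <-] supA].
have bound1 : exists C1 : R, forall x, M < enorm x -> `|f x| / enorm x ^ z <= C1.
  move: supA; case E : (ereal_sup _) => [s| |] sy.
  - exists s => x Mx; rewrite -lee_fin -E; apply: ereal_sup_ubound.
    by exists x => //; exact: MA.
  - by rewrite ltxx in sy.
  - exists 0 => x Mx; rewrite -lee_fin.
    apply: (@le_trans _ _ -oo%E); last exact: leNye.
    by rewrite -E; apply: ereal_sup_ubound; exists x => //; exact: MA.
have [C1 HC1] := bound1.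
pose M1 := Num.max M 1.
pose jz x : R := (1 + enorm (x : 'rV[R]_d) ^+ 2) `^ (z%:~R / 2).
have jz0 x : 0 < jz x by rewrite powR_gt0// jap_gt0.
have cg : continuous (fun x => `|f x| / jz x).
  apply: continuous_mul => x.
    apply: (@continuous_comp _ _ _ f (fun t : R => `|t|)); first exact: cf.
    exact: norm_continuous.
  rewrite (_ : (fun z => _) = fun v : 'rV[R]_d => (1 + enorm v ^+ 2) `^ (- (z%:~R / 2))).
    apply: (@continuous_powR_comp _ _ (fun z : 'rV[R]_d => 1 + enorm z ^+ 2)).
      exact: jap_gt0.
    apply: continuousD; first exact: cst_continuous.
    exact: continuous_enorm_sqr.
  by apply/funext => v; rewrite powRN.
have [C2 HC2] : exists C2 : R, forall x, enorm x ^+ 2 <= M1 ^+ 2 -> `|f x| / jz x <= C2.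
  have K := @compact_enorm_le (M1 ^+ 2).
  have cK : compact ((fun x => `|f x| / jz x) @` [set x | enorm x ^+ 2 <= M1 ^+ 2]).
    by apply: continuous_compact => //; exact: continuous_subspaceT.
  have [B [_ HB]] := compact_bounded cK.
  exists (B + 1) => x xM; apply: le_trans (ler_norm _) _.
  by apply: HB; [rewrite ltrDl|exists x].
(* For |x| >= 1, |x|^2 lies between (1 + |x|^2) / 2 and 1 + |x|^2; the constant
   C3 covers both signs of the exponent. *)
pose C3 : R := Num.max 1 (2 `^ (- (z%:~R / 2))).
have C30 : 0 < C3 by rewrite lt_max ltr01.
exists (Num.max 0 (Num.max (C1 * C3) C2)) => x.
rewrite -ler_pdivrMr ?jz0// le_max; apply/orP; right; rewrite le_max.
have [xM|xM] := leP (enorm x ^+ 2) (M1 ^+ 2); first by rewrite HC2 ?orbT.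
apply/orP; left.
have xM1 : M1 < enorm x.
  by rewrite -(@ltr_pXn2r _ 2)// ?nnegrE ?enorm_ge0// /M1 le_max ler01 orbT.
have Mx : M < enorm x by rewrite (le_lt_trans _ xM1)// /M1 le_max lexx.
have x1 : 1 < enorm x by rewrite (le_lt_trans _ xM1)// /M1 le_max lexx orbT.
have x0 : 0 < enorm x by exact: lt_trans x1.
have C10 : 0 <= C1.
  by apply: le_trans (HC1 x Mx); rewrite divr_ge0// exprz_ge0// ltW.
have -> : `|f x| / jz x = (`|f x| / enorm x ^ z) * (enorm x ^ z / jz x).
  by rewrite mulrA divfK// expfz_neq0// gt_eqF.
apply: ler_pM; [|by rewrite divr_ge0 ?exprz_ge0// ltW| exact: HC1|].
  by rewrite divr_ge0// exprz_ge0// ltW.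
have -> : enorm x ^ z = (enorm x ^+ 2) `^ (z%:~R / 2).
  rewrite -powR_intmul ?ltW// -[in RHS]powR_mulrn ?ltW// -powRrM.
  by congr (_ `^ _); rewrite mulrCA mulfV// mulr1.
rewrite ler_pdivrMr ?jz0// /jz /C3; set s := z%:~R / 2.
have e2 : enorm x ^+ 2 <= 1 + enorm x ^+ 2 by rewrite lerDr.
have e20 : 0 < enorm x ^+ 2 by rewrite exprn_gt0.
have e21 : 1 <= enorm x ^+ 2 by rewrite expr_ge1// ltW.
have [s0|s0] := leP 0 s.
  rewrite (@le_trans _ _ ((1 + enorm x ^+ 2) `^ s))//.
    by apply: ge0_ler_powR; rewrite ?nnegrE// ltW// jap_gt0.
  by rewrite ler_peMl ?powR_ge0// le_max lexx.
rewrite (@le_trans _ _ (2 `^ (- s) * (1 + enorm x ^+ 2) `^ s))//; last first.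
  by rewrite ler_wpM2r ?powR_ge0// le_max lexx orbT.
have -> : s = - - s by rewrite opprK.
set b := - s; have b0 : 0 <= b by rewrite oppr_ge0 ltW.
move: b b0 => b b0.
rewrite opprK !powRN ler_pdivlMr ?powR_gt0 ?jap_gt0//.
rewrite mulrC ler_pdivrMr ?powR_gt0//.
rewrite -(powRM _ (ler0n _ 2) (ltW e20)).
apply: ge0_ler_powR => //; first by rewrite nnegrE ltW// jap_gt0.
  by rewrite nnegrE mulr_ge0// ltW.
by move: e21; lra.
Qed.

End growth.

(** * Decay of the coefficients *)

Lemma esum_le_seq (R : realType) (T : choiceType) (D : set T) (a : T -> R) (B : R) :
  (forall S : seq T, uniq S -> (forall k, k \in S -> D k) ->
     \sum_(k <- S) a k <= B) ->
  (\esum_(k in D) (a k)%:E <= B%:E)%E.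
Proof.
move=> H; apply: ub_ereal_sup => _ [A [finA AD] <-].
rewrite fsbig_finite//= sumEFin lee_fin; apply: H => [|k]; first exact: finmap.fset_uniq.
by rewrite in_fset_set// inE => /AD.
Qed.

Section student_integrability.
Context {R : realType}.
Variable mu : R.
Hypothesis mu0 : 0 < mu.
Local Notation leb := (@lebesgue_measure R).
Local Notation nu := (student1 mu).

Lemma integrable_jap_student (g : R) : 2 * g < mu ->
  leb.-integrable setT (EFin \o (fun t => (1 + t ^+ 2) `^ g * nu t)).
Proof.
move=> gmu; have s0 : 0 < mu - 2 * g by rewrite subr_gt0.
have := integrableZl measurableT (student_cst mu) (integrable_jap s0).
apply: eq_integrable => // t _ /=; rewrite -EFinM; congr EFin.
rewrite /student1 mulrCA; congr (_ * _); rewrite -powRD; last first.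
  by rewrite (gt_eqF (jap_gt0 t)) implybT.
congr (_ `^ _); lra.
Qed.

Lemma integrable_jap_student_rV n (l : 'I_n) (g : R) : 2 * g < mu ->
  (lebesgue_rV n).-integrable setT
    (EFin \o (fun x : 'rV[R]_n => (1 + x 0 l ^+ 2) `^ g * student mu x)).
Proof.
move=> gmu.
pose h (j : 'I_n) t := if j == l then (1 + t ^+ 2) `^ g * nu t else nu t.
have hi j : leb.-integrable setT (EFin \o h j).
  rewrite /h; case: (j == l); first exact: integrable_jap_student.
  exact: integrable_student1.
have [+ _] := integrable_integral_prod hi; apply: eq_integrable => // x _ /=.
congr EFin; rewrite (bigD1 l)//= /student [in RHS](bigD1 l)//= mulrA.
rewrite /h eqxx; congr (_ * _); apply: eq_bigr => j jl.
by rewrite (negbTE jl).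
Qed.

Lemma integrable_student_le n (l : 'I_n) (g C : R) (f : 'rV[R]_n -> R) :
  2 * g < mu -> continuous f -> (forall x, `|f x| <= C * (1 + x 0 l ^+ 2) `^ g) ->
  (lebesgue_rV n).-integrable setT (EFin \o (fun x => f x * student mu x)).
Proof.
move=> gmu cf fC.
apply: (le_integrable measurableT _ _
  (integrableZl measurableT C (integrable_jap_student_rV l gmu))).
  apply/measurable_EFinP; apply: continuous_measurable_rV.
  exact: continuous_mul cf (continuous_student mu0).
move=> x _; rewrite /= lee_fin mulrA !normrM.
apply: ler_wpM2r => //; apply: le_trans (fC x) _.
by rewrite -normrM ler_norm.
Qed.

Lemma integrable_student1_le (g C : R) (f : R -> R) :
  2 * g < mu -> continuous f -> (forall t, `|f t| <= C * (1 + t ^+ 2) `^ g) ->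
  leb.-integrable setT (EFin \o (fun t => f t * nu t)).
Proof.
move=> gmu cf fC.
apply: (le_integrable measurableT _ _
  (integrableZl measurableT C (integrable_jap_student gmu))).
  apply/measurable_EFinP; apply: continuous_measurable_fun.
  exact: continuous_mul cf (@continuous_student1 R mu).
move=> x _; rewrite /= lee_fin [in leRHS]mulrA (normrM (f x)) [leRHS]normrM.
apply: ler_wpM2r => //; apply: le_trans (fC x) _.
exact: ler_norm.
Qed.

Lemma cvg_jap_nat (g : R) : g < 0 -> (1 + n%:R ^+ 2) `^ g @[n --> \oo] --> (0 : R).
Proof.
move=> g0; have ng0 : 0 < - g by rewrite oppr_gt0.
have C : (1 + n%:R) `^ g @[n --> \oo] --> (0 : R).
  have := @cvgy_powRN R _ ng0; rewrite opprK => C.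
  exact: (@cvg_comp _ _ _ (fun n : nat => n%:R) _ _ _ _ (@cvgr_idn R) C).
apply: (@squeeze_cvgr _ _ _ _ (fun=> 0) (fun n : nat => (1 + n%:R) `^ g)) => //.
  2: exact: cvg_cst.
near=> n; rewrite powR_ge0/= -[g]opprK powRN (powRN _ (- g)).
rewrite lef_pV2 ?posrE ?powR_gt0 ?jap_gt0 ?ltr_pwDl//.
apply: ge0_ler_powR; rewrite ?nnegrE ?(ltW ng0) ?(ltW (jap_gt0 _)) ?addr_ge0//.
by rewrite lerD2l -natrX ler_nat -mulnn; case: (n) => // m; exact: leq_pmulr.
Unshelve. all: by end_near. Qed.

End student_integrability.

#[local] Arguments wderiv : simpl never.

Section coefficients.
Context {R : realType} {n : nat}.
Variables (mu q : R) (y : 'rV[R]_n.+1 -> R) (r p : nat) (l : 'I_n.+1).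
Hypothesis mu0 : 0 < mu.
Hypothesis r1 : (1 <= r)%N.
Hypothesis yC : coordinatewise_C r setT y.
Hypothesis growth : forall k, (k <= r)%N -> exists C : R, forall x,
  `|partialn l k y x| <= C * (1 + enorm x ^+ 2) `^ ((p%:R - k%:R) / 2).
Hypothesis hpq : p%:R + (r%:R - 1 / 2) * mu < q.
Local Notation e_l := (delta_mx 0 l : 'rV[R]_n.+1).
Local Notation leb := (@lebesgue_measure R).
Local Notation lebd := (lebesgue_rV n.+1).
Local Notation nu := (student1 mu).
Local Notation W := (wderiv mu q y l).
Implicit Types (x : 'rV[R]_n.+1) (k : {ffun 'I_n.+1 -> nat}).

(** In terms of [x_l] alone, the [c]-th weighted derivative grows at most like the
    power [beta c] of [1 + x_l ^+ 2]: it is square integrable when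
    [4 * beta c < mu], and vanishes at infinity when [beta c < 0]. *)
Let beta (c : nat) : R := (c%:R * mu + p%:R - q) / 2.

Let pq0 : p%:R - q <= 0.
Proof.
have r0 : 0 <= r%:R - 1 :> R by rewrite subr_ge0 ler1n.
by have := mulr_ge0 r0 (ltW mu0); move: hpq mu0; lra.
Qed.

Let beta_mu c : (c <= r)%N -> 4 * beta c < mu.
Proof.
move=> cr; have : c%:R * mu <= r%:R * mu by rewrite ler_wpM2r ?ler_nat// ltW.
rewrite /beta; move: hpq; lra.
Qed.

Let beta_mu2 c : (c <= r)%N -> 2 * beta c < mu.
Proof. by move=> /beta_mu; move: mu0; lra. Qed.

Let beta_lt0 c : (c < r)%N -> beta c < 0.
Proof.
move=> cr; have : c.+1%:R * mu <= r%:R * mu by rewrite ler_wpM2r ?ler_nat// ltW.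
by rewrite /beta -natr1; move: hpq mu0; lra.
Qed.

Let cW c : (c <= r)%N -> continuous (W c).
Proof. by move=> cr x; exact: (@continuous_wderiv _ _ _ _ _ _ _ mu0 yC _ cr x). Qed.

Lemma wderiv_coord_bound c : (c <= r)%N -> exists C : R, 0 <= C /\
  forall x, `|W c x| <= C * (1 + x 0 l ^+ 2) `^ (beta c).
Proof.
move=> cr; have [C [C0 HC]] := wderiv_bound q mu0 yC growth cr.
exists C; split => // x; apply: le_trans (HC x) _; rewrite -mulrA.
apply: ler_wpM2l => //.
have -> : beta c = c%:R * mu / 2 + (p%:R - q) / 2 by rewrite /beta; lra.
rewrite powRD; last by rewrite (gt_eqF (jap_gt0 _)) implybT.
apply: ler_wpM2l; first exact: powR_ge0.
set s := (p%:R - q) / 2; have s0 : 0 <= - s by rewrite oppr_ge0 /s; move: pq0; lra.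
move: s s0 => s s0; rewrite -[s]opprK powRN (powRN _ (- s)).
rewrite lef_pV2 ?posrE ?powR_gt0 ?jap_gt0//.
apply: ge0_ler_powR => //; rewrite ?nnegrE ?(ltW (jap_gt0 _))//.
by rewrite lerD2l coord_enorm.
Qed.

(** The cosine basis, with the phase of the [l]-th factor shifted by [c] quarter
    periods; the [l]-th factor only agrees with that of [phi] when [c = 0] and
    [0 < k l]. *)
Definition shifted_basis c k x : R :=
  \prod_(j < n.+1) (if j == l then shifted_cos mu c (k j) (x 0 j)
                    else phi1 mu (k j) (x 0 j)).
Local Notation E := shifted_basis.

Lemma continuous_shifted_basis c k : continuous (E c k).
Proof.
apply: continuous_big => [|j _ x]; first exact: mul_continuous.
have cj := @coord_continuous R 1 n.+1 0 j x.
case: (j == l); apply: (continuous_comp cj).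
  exact: continuous_shifted_cos.
exact: continuous_phi1.
Qed.

Lemma shifted_basis_bound c k x : `|E c k x| <= Num.sqrt 2 ^+ n.+1.
Proof.
have -> : Num.sqrt 2 ^+ n.+1 = \prod_(j < n.+1) Num.sqrt (2 : R).
  by rewrite prodr_const card_ord.
rewrite normr_prod; apply: ler_prod => j _.
rewrite normr_ge0/=; case: (j == l); first exact: shifted_cos_bound.
exact: phi1_bound.
Qed.

Lemma integrable_wderiv_basis c k : (c <= r)%N ->
  lebd.-integrable setT (EFin \o (fun x => W c x * E c k x * student mu x)).
Proof.
move=> cr; have [C [C0 HC]] := wderiv_coord_bound cr.
apply: (integrable_student_le mu0 (beta_mu2 cr) (C := C * Num.sqrt 2 ^+ n.+1)).
  apply: continuous_mul; last exact: continuous_shifted_basis.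
  exact: cW.
move=> x; rewrite normrM mulrAC; apply: ler_pM => //.
exact: shifted_basis_bound.
Qed.

Lemma integrable_wderiv_sqr c : (c <= r)%N ->
  lebd.-integrable setT (EFin \o (fun x => W c x ^+ 2 * student mu x)).
Proof.
move=> cr; have [C [C0 HC]] := wderiv_coord_bound cr.
apply: (@integrable_student_le _ _ mu0 _ l (2 * beta c) (C ^+ 2)).
- by have := beta_mu cr; lra.
- by move=> x; apply: exp_continuous; exact: cW.
move=> x; rewrite normrX.
have -> : C ^+ 2 * (1 + x 0 l ^+ 2) `^ (2 * beta c) =
    (C * (1 + x 0 l ^+ 2) `^ (beta c)) ^+ 2.
  rewrite exprMn; congr (_ * _).
  by rewrite -[RHS]powR_mulrn ?powR_ge0// -powRrM mulrC.
by rewrite ler_sqr ?nnegrE ?mulr_ge0 ?powR_ge0.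
Qed.

Lemma integrable_basisM c k k' :
  lebd.-integrable setT (EFin \o (fun x => E c k x * E c k' x * student mu x)).
Proof.
apply: (@integrable_student_le _ _ mu0 _ l 0 (Num.sqrt 2 ^+ n.+1 * Num.sqrt 2 ^+ n.+1)).
- by rewrite mulr0.
- by apply: continuous_mul; exact: continuous_shifted_basis.
move=> x; rewrite powRr0 mulr1 normrM; apply: ler_pM => //; exact: shifted_basis_bound.
Qed.

(** Constants along the [l]-th axis are excluded: they need not be orthogonal to
    the shifted cosines. *)
Lemma basis_orthonormal c k k' : (0 < k l)%N -> (0 < k' l)%N ->
  (\int[lebd]_x (E c k x * E c k' x * student mu x) = (k == k')%:R)%R.
Proof.
move=> kl k'l.
pose h (j : 'I_n.+1) t :=
  (if j == l then shifted_cos mu c (k j) t else phi1 mu (k j) t) *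
  (if j == l then shifted_cos mu c (k' j) t else phi1 mu (k' j) t) * nu t.
have hi j : leb.-integrable setT (EFin \o h j).
  apply: (@integrable_student1_le _ _ 0 (Num.sqrt 2 * Num.sqrt 2)) => //.
  - by rewrite mulr0.
  - apply: continuous_mul; case: (j == l); try exact: continuous_shifted_cos;
      exact: continuous_phi1.
  - move=> t; rewrite powRr0 mulr1 normrM; apply: ler_pM => //;
      case: (j == l); try exact: shifted_cos_bound; exact: phi1_bound.
have [_ H] := integrable_integral_prod hi.
transitivity (\prod_(j < n.+1) (k j == k' j)%:R : R).
  transitivity (\int[lebd]_x (\prod_(j < n.+1) h j (x 0 j)))%R.
    by apply: eq_Rintegral => x _; rewrite /h /shifted_basis /student -!big_split.
  rewrite H; apply: eq_bigr => j _; rewrite /h.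
  have [->|_] := eqVneq j l; first exact: integral_shifted_cosM.
  exact: integral_phi1M.
have [->|kk'] := eqVneq k k'; first by rewrite big1// => j _; rewrite eqxx.
have [j jk] : exists j, k j != k' j.
  apply/existsP; apply: contraNT kk'; rewrite negb_exists => /forallP H'.
  by apply/eqP/ffunP => j; apply/eqP; have := H' j; rewrite negbK.
by rewrite (bigD1 j)//= (negbTE jk) mul0r.
Qed.

(** The coefficient of the [c]-th weighted derivative on the basis function of
    index [k] shifted [c] times. *)
Definition shifted_coef c k : R :=
  (\int[lebd]_x (W c x * E c k x * student mu x))%R.

(** As [t] varies, [ins l (t, v)] runs through a line parallel to the [l]-th
    axis. *)
Lemma insE t v : ins l (t, v) = t *: e_l + ins l (0, v) :> 'rV[R]_n.+1.
Proof.
apply/rowP => j; rewrite [RHS]mxE [X in X + _]mxE [X in t * X]mxE eqxx/=.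
case: (unliftP l j) => [i|] ->.
  by rewrite !ins_lift eq_sym (negbTE (neq_lift _ _)) mulr0 add0r.
by rewrite !ins_id eqxx mulr1 addr0.
Qed.

Lemma shifted_coef_parts c k : (c < r)%N -> (0 < k l)%N ->
  shifted_coef c k = - ((k l)%:R * pi)^-1 * shifted_coef c.+1 k.
Proof.
move=> cr kl; set a := - _^-1.
have ic := integrable_wderiv_basis k (ltnW cr).
have ic1 := integrable_wderiv_basis k cr.
rewrite /shifted_coef -RintegralZl//.
have iac1 : lebd.-integrable setT
    (EFin \o (fun x => a * (W c.+1 x * E c.+1 k x * student mu x))).
  by have := integrableZl measurableT a ic1; apply: eq_integrable.
rewrite /Rintegral (integral_ins l ic) (integral_ins l iac1); congr fine.
(* Both sides are integrated along the l-th axis first; what remains is the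
   one-dimensional integration by parts along the line through v. *)
apply: eq_integral => v _ /=.
pose K : R := (\prod_(j < n) phi1 mu (k (lift l j)) (v 0 j)) * student mu v.
have Ek b t : E b k (ins l (t, v)) =
    shifted_cos mu b (k l) t * \prod_(j < n) phi1 mu (k (lift l j)) (v 0 j).
  rewrite /shifted_basis (bigD1_ord l)//= eqxx ins_id; congr (_ * _).
  apply: eq_bigr => j _.
  by rewrite ins_lift eq_sym (negbTE (neq_lift _ _)).
have Es t : student mu (ins l (t, v)) = nu t * student mu v.
  rewrite /student (bigD1_ord l)//= ins_id; congr (_ * _).
  by apply: eq_bigr => j _; rewrite ins_lift.
pose s b t := W b (ins l (t, v)).
have cins : continuous (fun t => ins l (t, v)).
  move=> t; apply: continuous_rV => j; case: (unliftP l j) => [i|] ->.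
    by rewrite ins_lift; under eq_fun do rewrite ins_lift; exact: cvg_cst.
  by rewrite ins_id; under eq_fun do rewrite ins_id; exact: cvg_id.
have cs b : (b <= r)%N -> continuous (s b).
  move=> br t; apply: (continuous_comp (cins t)).
  exact: (cW br).
have sb b : (b <= r)%N -> exists C : R, 0 <= C /\
    forall t, `|s b t| <= C * (1 + t ^+ 2) `^ (beta b).
  move=> br; have [C [C0 HC]] := wderiv_coord_bound br; exists C; split => // t.
  by have := HC (ins l (t, v)); rewrite ins_id.
have si b : (b <= r)%N -> leb.-integrable setT (EFin \o (fun t => s b t * nu t)).
  move=> br; have [C [_ HC]] := sb b br.
  exact: integrable_student1_le (beta_mu2 br) (cs b br) HC.
have sci b m : (b <= r)%N ->
    leb.-integrable setT (EFin \o (fun t => s b t * shifted_cos mu b m t * nu t)).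
  move=> br.
  have := integrable_bounded_mul (@continuous_shifted_cos R mu mu0 b m)
    (shifted_cos_bound mu b m) (si b br).
  by apply: eq_integrable => // t _ /=; rewrite mulrA (mulrC (s b t)).
have Ds (t : R) : is_derive t 1 (s c) (s c.+1 t * nu t).
  rewrite /s; under [X in is_derive _ _ X]eq_fun do rewrite insE.
  have := is_derive_wderiv q l mu0 yC (ins l (t, v)) cr; rewrite ins_id.
  move=> /is_derive_slice D.
  pose g u := W c (u *: e_l + ins l (t, v)).
  have -> : (fun u => W c (u *: e_l + ins l (0, v))) = (fun u => g (u - t)).
    apply/funext => u; rewrite /g [in RHS]insE addrA -scalerDl subrK//.
  rewrite -[X in is_derive _ _ _ X]mulr1.
  apply: (@is_derive1_comp R g (fun u => u - t)); first by rewrite subrr.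
  rewrite -[X in is_derive _ _ _ X]subr0.
  exact: is_deriveB (is_derive_id _ _) (is_derive_cst _ _ _).
have [C [C0 HC]] := sb c (ltnW cr).
have cvgC : C * (1 + m%:R ^+ 2) `^ (beta c) @[m --> \oo] --> (0 : R).
  rewrite -[X in _ --> X](mulr0 C); apply: cvgM; first exact: cvg_cst.
  exact: cvg_jap_nat (beta_lt0 cr).
have cvgs (u : nat -> R) : (forall m, u m ^+ 2 = m%:R ^+ 2) ->
    s c (u m) @[m --> \oo] --> (0 : R).
  move=> um; apply: norm_cvg0.
  apply: (@squeeze_cvgr _ _ _ _ (fun=> 0)
    (fun m : nat => C * (1 + m%:R ^+ 2) `^ (beta c))) => //; last exact: cvg_cst.
  by near=> m; rewrite normr_ge0/= -um.
have parts : (\int[leb]_t (s c t * shifted_cos mu c (k l) t * nu t) =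
    a * \int[leb]_t (s c.+1 t * shifted_cos mu c.+1 (k l) t * nu t))%R.
  have c1 : s c (- m%:R) @[m --> \oo] --> (0 : R) by apply: cvgs => m; rewrite sqrrN.
  have c2 : s c m%:R @[m --> \oo] --> (0 : R) by exact: cvgs.
  exact: (integral_shifted_cos_parts mu0 c kl Ds (cs _ cr) (si _ (ltnW cr))
    (si _ cr) c1 c2).
transitivity ((\int[leb]_t (s c t * shifted_cos mu c (k l) t * nu t * K))%R%:E).
  rewrite /Rintegral fineK.
    apply: eq_integral => t _; congr EFin; rewrite Ek Es /K /s; ring.
  apply: integrable_fin_num => //.
  by have := integrableZr measurableT K (sci c (k l) (ltnW cr)); apply: eq_integrable.
rewrite RintegralZr//; last exact: sci (ltnW cr).
rewrite parts -mulrA -RintegralZr//; last exact: sci.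
have iK : leb.-integrable setT
    (EFin \o (fun t => s c.+1 t * shifted_cos mu c.+1 (k l) t * nu t * K)).
  by have := integrableZr measurableT K (sci c.+1 (k l) cr); apply: eq_integrable.
rewrite -RintegralZl// /Rintegral fineK.
  apply: eq_integral => t _; congr EFin; rewrite Ek Es /K /s; ring.
apply: integrable_fin_num => //.
by have := integrableZl measurableT a iK; apply: eq_integrable.
Unshelve. all: by end_near. Qed.

Lemma coef_shifted k : (0 < k l)%N -> coef mu q y k = shifted_coef 0 k.
Proof.
move=> kl; apply: eq_Rintegral => x _; congr (_ * _ * _).
apply: eq_bigr => j _; have [->|//] := eqVneq j l.
by rewrite phi1E; case: (k l) kl.
Qed.

Lemma coef_sqr k : (0 < k l)%N ->
  coef mu q y k ^+ 2 = ((k l)%:R * pi) ^- (2 * r) * shifted_coef r k ^+ 2.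
Proof.
move=> kl; rewrite coef_shifted//.
have H c : (c <= r)%N ->
    shifted_coef 0 k = (- ((k l)%:R * pi)^-1) ^+ c * shifted_coef c k.
  elim: c => [|c IH] cr; first by rewrite mul1r.
  by rewrite (IH (ltnW cr)) (shifted_coef_parts cr kl) mulrA -exprSr.
by rewrite (H r)// exprMn -exprM mulnC exprM sqrrN -exprM exprVn.
Qed.

(** The squared norm of the last weighted derivative against the Student law. *)
Definition wderiv_sqnorm : R := (\int[lebd]_x (W r x ^+ 2 * student mu x))%R.

Lemma smoothness_cstE :
  smoothness_cst mu q y l r = (pi ^- (2 * r) * wderiv_sqnorm)%:E.
Proof.
rewrite /smoothness_cst EFinM; congr (_ * _)%E.
transitivity (\int[lebd]_(u in open_cube)
    ((fun x => W r x ^+ 2) (student_quantiles mu u))%:E)%E.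
  apply: eq_integral => u /set_mem cu.
  by rewrite (partialn_damped_cube q l mu0 yC (leqnn r) cu) real_normK// num_real.
have cW2 : continuous (fun x => W r x ^+ 2).
  by move=> x; apply: exp_continuous; exact: cW.
rewrite (integral_student_quantiles mu0 cW2 (fun x => sqr_ge0 _)).
rewrite /wderiv_sqnorm /Rintegral fineK//.
apply: integrable_fin_num => //; exact: integrable_wderiv_sqr.
Qed.

Lemma coef_bessel (K : nat) (S : seq {ffun 'I_n.+1 -> nat}) : uniq S ->
  \sum_(k <- S | (K < k l)%N) coef mu q y k ^+ 2 <=
  pi ^- (2 * r) * wderiv_sqnorm * (K.+1%:R ^+ (2 * r))^-1.
Proof.
move=> uS; rewrite -big_filter; set S' := [seq _ <- _ | _].
have S'K k : k \in S' -> (K < k l)%N by rewrite mem_filter => /andP[].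
have S'0 k : k \in S' -> (0 < k l)%N by move=> /S'K; exact: leq_trans.
have uS' : uniq S' by exact: filter_uniq.
have pi0 : 0 < pi :> R by exact: pi_gt0.
apply: (@le_trans _ _ (pi ^- (2 * r) * (K.+1%:R ^+ (2 * r))^-1 *
    \sum_(k <- S') shifted_coef r k ^+ 2)).
  rewrite mulr_sumr big_seq [leRHS]big_seq; apply: ler_sum => k kS.
  rewrite coef_sqr ?S'0//; apply: ler_wpM2r; first exact: sqr_ge0.
  rewrite exprMn invfM mulrC; apply: ler_wpM2l.
    by rewrite invr_ge0 exprn_ge0// ltW.
  rewrite lef_pV2 ?posrE ?exprn_gt0 ?ltr0n ?S'0//.
  by rewrite lerXn2r ?nnegrE// ler_nat S'K.
rewrite mulrAC; apply: ler_wpM2r.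
  by rewrite invr_ge0 exprn_ge0.
apply: ler_wpM2l; first by rewrite invr_ge0 exprn_ge0// ltW.
have ort k k' : k \in S' -> k' \in S' ->
    (\int[lebd]_x (E r k x * E r k' x * student mu x))%R = (k == k')%:R.
  by move=> kS k'S; rewrite basis_orthonormal ?S'0.
exact: (bessel uS' (fun x => student_ge0 x mu0) (integrable_wderiv_sqr (leqnn r))
  (fun k => integrable_wderiv_basis k (leqnn r)) (integrable_basisM r) ort).
Qed.

Lemma integrable_coef k :
  lebd.-integrable setT (EFin \o coef_integrand mu q y k).
Proof.
have [C [C0 HC]] := wderiv_coord_bound (leq0n r).
apply: (integrable_student_le mu0 (beta_mu2 (leq0n r)) (C := C * Num.sqrt 2 ^+ n.+1)).
  apply: continuous_mul; first exact: (cW (leq0n r)).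
  apply: continuous_big => [|j _ x]; first exact: mul_continuous.
  apply: (continuous_comp (@coord_continuous R 1 n.+1 0 j x)).
  exact: continuous_phi1.
move=> x; rewrite normrM mulrAC; apply: ler_pM => //; first exact: HC.
have -> : Num.sqrt 2 ^+ n.+1 = \prod_(j < n.+1) Num.sqrt (2 : R).
  by rewrite prodr_const card_ord.
rewrite /phi normr_prod; apply: ler_prod => j _.
by rewrite normr_ge0/= phi1_bound.
Qed.

End coefficients.

Theorem proposition4 (R : realType)
  (d dW N : nat) (hd : (1 <= d)%N) (hN : (1 <= N)%N)
  (T : R) (hT : 0 < T)
  (dOmega : measure_display) (Omega : measurableType dOmega)
  (P : probability Omega R) (W : R -> Omega -> 'rV[R]_dW)
  (hW : brownian_motion P W)
  (b : R -> 'rV[R]_d -> 'rV[R]_d) (sigma : R -> 'rV[R]_d -> 'M[R]_(d, dW))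
  (hbm : measurable_fun (`[0, T] `*` setT) (fun z : R * 'rV[R]_d => b z.1 z.2))
  (hsm : measurable_fun (`[0, T] `*` setT)
           (fun z : R * 'rV[R]_d => sigma z.1 z.2))
  (hbb : exists M : R, forall t x, 0 <= t <= T -> `|b t x| <= M)
  (hsb : exists M : R, forall t x, 0 <= t <= T -> `|sigma t x| <= M)
  (g : 'rV[R]_d -> R) (Cg etag : R) (hCg : 0 <= Cg) (hetag : 0 <= etag)
  (hgm : measurable_fun setT g)
  (hg : forall x, `|g x| <= Cg * (1 + enorm x ^+ 2) `^ (etag / 2))
  (f : R -> 'rV[R]_d -> R -> R) (Lf Cf etaf : R)
  (hLf : 0 <= Lf) (hCf : 0 <= Cf) (hetaf : 0 <= etaf)
  (hfm : forall j, (j < N)%N ->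
     measurable_fun setT (fun z : 'rV[R]_d * R => f (grid T N j) z.1 z.2))
  (hfL : forall j x u u', (j < N)%N ->
     `|f (grid T N j) x u - f (grid T N j) x u'| <= Lf * `|u - u'|)
  (hf0 : forall j x, (j < N)%N ->
     `|f (grid T N j) x 0| <= Cf * (1 + enorm x ^+ 2) `^ (etaf / 2))
  (y : nat -> 'rV[R]_d -> R)
  (hy : value_functions P W T N b sigma g f y)
  (mu q : R) (hmu : 0 < mu) (hq : 0 <= q)
  (i : nat) (hi : (i <= N)%N)
  (r : nat) (hr : (1 <= r)%N)
  (hyC : coordinatewise_C r setT (y i))
  (p : nat)
  (hlim : forall (l : 'I_d) (n : nat), (n <= r)%N ->
     (limf_esup (fun x => (`|partialn l n (y i) x| /
        enorm x ^ (p%:Z - n%:Z))%:E) enorm_pinfty < +oo)%E)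
  (hpq : p%:R + (r%:R - 1 / 2) * mu < q) :
  (* well-definedness of the derivatives and integrals below *)
  coordinatewise_C r open_cube (damped_cube mu q (y i)) /\
  (forall k : {ffun 'I_d -> nat},
     (lebesgue_rV d).-integrable setT
       (EFin \o coef_integrand mu q (y i) k)) /\
  (forall l : 'I_d, (smoothness_cst mu q (y i) l r < +oo)%E) /\
  (forall K : 'I_d -> nat,
     (\esum_(k in [set k : {ffun 'I_d -> nat} | exists l, (K l < k l)%N])
        (`|coef mu q (y i) k| ^+ 2)%:E <=
      \sum_(l < d) smoothness_cst mu q (y i) l r *
        (((K l).+1%:R ^+ (2 * r))^-1)%:E)%E).
Proof.
clear hy hf0 hfL hfm f hg hgm g hsb hbb hsm hbm sigma b.
case: d hd y hyC hlim => [//|n] _ y hyC hlim.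
have growth (l : 'I_n.+1) k : (k <= r)%N -> exists C : R, forall x,
    `|partialn l k (y i) x| <= C * (1 + enorm x ^+ 2) `^ ((p%:R - k%:R) / 2).
  move=> kr; have [_ /(_ k kr) ck] := hyC l.
  have [|C HC] := limf_esup_growth _ (hlim l k kr).
    by move=> x; exact: ck.
  by exists C => x; have := HC x; rewrite intrB.
split; [|split; [|split]].
- move=> l; split => m mr u cu.
    exact: (damped_cube_derivable hmu hyC mr cu).
  exact: (@damped_cube_continuous _ _ _ _ _ _ _ hmu hyC _ _ mr cu).
- by move=> k; exact: (integrable_coef hmu hr hyC (growth ord0) hpq).
- by move=> l; rewrite (smoothness_cstE hmu hr hyC (growth l) hpq) ltry.
- move=> K.
  under [leRHS]eq_bigr => l _ do
    rewrite (smoothness_cstE hmu hr hyC (growth l) hpq) -EFinM.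
  rewrite sumEFin; apply: esum_le_seq => S uS SK.
  under eq_bigr do rewrite real_normK ?num_real//.
  (* Each index of the sum exceeds K in at least one coordinate. *)
  have le1 : \sum_(l < n.+1) \sum_(k <- S | (K l < k l)%N)
        coef mu q (y i) k ^+ 2 <=
      \sum_(l < n.+1) pi ^- (2 * r) * wderiv_sqnorm mu q (y i) r l /
        (K l).+1%:R ^+ (2 * r).
    apply: ler_sum => l _.
    exact: (coef_bessel hmu hr hyC (growth l) hpq (K l) uS).
  apply: le_trans le1.
  under [leRHS]eq_bigr do rewrite big_mkcond/=.
  rewrite exchange_big/= big_seq [leRHS]big_seq; apply: ler_sum => k kS.
  have [l Kl] := SK k kS.
  rewrite (bigD1 l)//= Kl lerDl; apply: sumr_ge0 => j _.
  by case: ifP => // _; exact: sqr_ge0.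
Qed.
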